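(* Assume that $\xi_p\in F$; that if $p=2$ and $n=1$ then $-1\in N_{K/F}(K^\times)$; and that we are not in the case ($p=2$ and $\omega=1<\nu$). Let $m\ge 1$ and let $(\mathbf a,d)$ be a minimal norm pair of length $m$. Then: (1) If $\omega<\nu$, then for every integer $\tilde d$ with $\tilde d\equiv d \pmod{p^\nu}$ (when $\nu=\infty$ this means $\tilde d=d$), the pair $(\mathbf a,\tilde d)$ is a minimal norm pair of length $m$. (2) If $\omega=\nu$, then $d\equiv 1\pmod{p^m}$. (3) $d\equiv \chi(\sigma)\pmod{p^{\min\{m,\nu\}}}$, where $\chi$ is the cyclotomic character of $K/F$.
   Context: Let $p$ be a prime, $n\ge1$, and $K/F$ a cyclic Galois extension of degree $p^n$ with $\mathrm{char}(K)\neq p$; $G=\mathrm{Gal}(K/F)=\langle\sigma\rangle$. For $0\le i\le n$ let $K_i$ be the intermediate field with $[K_i:F]=p^i$. For $k\ge1$, $\xi_{p^k}$ denotes a primitive $p^k$-th root of unity (in an algebraic closure) and $\mu_{p^k}$ the group of $p^k$-th roots of unity. Put $\omega=\infty$ if $\mu_{p^k}\subseteq F$ for all $k$, otherwise $\omega$ is the integer with $\mu_{p^\omega}\subseteq F$, $\mu_{p^{\omega+1}}\not\subseteq F$; define $\nu$ the same way with $K$ in place of $F$. $U_i=1+p^i\mathbb Z$, and $v_p$ is the $p$-adic valuation. Conventions: $-\infty$ is smaller than every integer, $-\infty+c=-\infty$, $p^{-\infty}=0$. Norm pair: for $m\ge1$, a pair $(\mathbf a,d)$ with $\mathbf a=(a_0,\dots,a_{m-1})\in\{-\infty,0,1,\dots,n\}^m$,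 $a_0<n$, and $d\in U_1$ is a norm pair of length $m$ if there exist $\alpha,\delta_m\in K^\times$ and $\delta_i\in K_{a_i}^\times$ for $0\le i<m$ (with $\delta_i=1$ when $a_i=-\infty$) such that $\sigma(\alpha)=\alpha^d\delta_0\delta_1^p\cdots\delta_m^{p^m}$ and $\xi_p=N_{K/F}(\alpha)^{(d-1)/p}\,N_{K_{n-1}/F}(\delta_0)\prod_{i=1}^m N_{K/F}(\delta_i)^{p^{i-1}}$ for a fixed primitive $p$-th root of unity $\xi_p$; one says $(\alpha,\{\delta_i\}_{i=0}^m)$ represents $(\mathbf a,d)$. Order: $(\mathbf a,d)\le(\mathbf a',d')$ if $\mathbf a<\mathbf a'$ lexicographically, or $\mathbf a=\mathbf a'$ and $\min\{v_p(d'-1),m\}\le\min\{v_p(d-1),m\}$. A norm pair of length $m$ is minimal if it is $\le$ every norm pair of length $m$. Cyclotomic character: $\chi(\sigma)$ is the element of $(\mathbb Z/p^\nu\mathbb Z)^\times$ (of $\mathbb Z_p^\times$ if $\nu=\infty$) with $\sigma(\zeta)=\zeta^{\chi(\sigma)}$ for all $\zeta\in\mu_{p^\nu}$ (all $p$-power roots of unity if $\nu=\infty$). *)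

(* Defs.v *)
From HB Require Import structures.
From mathcomp Require Import all_boot all_order all_algebra all_fingroup all_field.
Set Implicit Arguments. Unset Strict Implicit. Unset Printing Implicit Defensive.
Import Order.TTheory GRing.Theory Num.Theory.
Local Open Scope ring_scope.

(* Conventions:
   - K/F is modelled by subfields F <= K of an ambient (finite-dimensional)
     splitting field L over some base field F0 (galois F K).
   - Extended naturals are [option nat].  For omega/nu, [None] = +infinity;
     for the entries a_i of a norm pair, [None] = -infinity. *)

Definition olt_inf (a b : option nat) : bool :=
  match a, b with
  | Some x, Some y => (x < y)%N
  | Some _, None => true
  | None, _ => false
  end.

Definition olt_minf (a b : option nat) : bool :=
  match a, b with
  | Some x, Some y => (x < y)%N
  | None, Some _ => true
  | _, None => false
  end.

Fixpoint lexlt (s t : seq (option nat)) : bool :=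
  match s, t with
  | x :: s', y :: t' => olt_minf x y || ((x == y) && lexlt s' t')
  | _, _ => false
  end.

(* min{v_p(x), m}, with v_p(0) = +oo *)
Definition vmin (p m : nat) (x : int) : nat :=
  if x == 0 then m else minn (logn p (absz x)) m.

Definition congr_ext (p : nat) (nu : option nat) (x y : int) : Prop :=
  match nu with
  | Some v => (x == y %[mod (p ^ v)%N])%Z
  | None => x = y
  end.

Definition min_ext (m : nat) (nu : option nat) : nat :=
  match nu with Some v => minn m v | None => m end.

Section Defs.
Variables (F0 : fieldType) (L : splittingFieldType F0).

(* mu_{p^k} is contained in E (equivalently: E contains a primitive p^k-th
   root of unity; char <> p) *)
Definition mu_sub (p : nat) (E : {vspace L}) (k : nat) : Prop :=
  exists z : L, z \in E /\ (p ^ k)%N.-primitive_root z.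

Definition is_mu_level (p : nat) (E : {vspace L}) (w : option nat) : Prop :=
  match w with
  | Some k => mu_sub p E k /\ ~ mu_sub p E k.+1
  | None => forall k, mu_sub p E k
  end.

(* c represents chi(sigma) modulo p^j: sigma(z) = z^c for all z in mu_{p^j}
   (contained in K) *)
Definition chi_mod_spec (p : nat) (K : {subfield L}) (s : gal_of K)
    (j : nat) (c : int) : Prop :=
  forall z : L, z \in K -> z ^+ (p ^ j) = 1 -> s z = z ^ c.

Definition norm_pair (p n : nat) (F K : {subfield L}) (s : gal_of K)
    (Ki : nat -> {subfield L}) (xi : L) (m : nat)
    (a : seq (option nat)) (d : int) : Prop :=
  [/\ size a = m,
      all (fun x => if x is Some k then (k <= n)%N else true) a,
      olt_minf (nth None a 0) (Some n),
      (p %| d - 1)%Z &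
      exists (alpha : L) (delta : nat -> L),
        [/\ alpha \in K /\ alpha != 0,
            delta m \in K /\ delta m != 0,
            (forall i, (i < m)%N ->
               match nth None a i with
               | Some k => delta i \in Ki k /\ delta i != 0
               | None => delta i = 1
               end),
            s alpha = alpha ^ d * \prod_(i < m.+1) delta i ^+ (p ^ i) &
            xi = galNorm F K alpha ^ ((d - 1) %/ p)%Z
                 * galNorm F (Ki n.-1) (delta 0%N)
                 * \prod_(1 <= i < m.+1) galNorm F K (delta i) ^+ (p ^ i.-1)]].

Definition np_le (p m : nat) (a : seq (option nat)) (d : int)
    (a' : seq (option nat)) (d' : int) : bool :=
  lexlt a a' || ((a == a') && (vmin p m (d' - 1) <= vmin p m (d - 1))%N).

Definition minimal_norm_pair (p n : nat) (F K : {subfield L}) (s : gal_of K)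
    (Ki : nat -> {subfield L}) (xi : L) (m : nat)
    (a : seq (option nat)) (d : int) : Prop :=
  @norm_pair p n F K s Ki xi m a d /\
  forall a' d', @norm_pair p n F K s Ki xi m a' d' -> np_le p m a d a' d'.

End Defs.
Arguments norm_pair {F0 L} p n F K s Ki xi m a d.
Arguments minimal_norm_pair {F0 L} p n F K s Ki xi m a d.

(* Main.v *)
Require Import Defs.
From HB Require Import structures.
From mathcomp Require Import all_boot all_order all_algebra all_fingroup all_solvable all_field.
From mathcomp Require Import ring zify.
Set Implicit Arguments. Unset Strict Implicit. Unset Printing Implicit Defensive.
Import Order.TTheory GRing.Theory Num.Theory.
Local Open Scope ring_scope.

(* Write K^* additively as a module over Z[X], with X acting as sigma; besides
   Hilbert 90 and the p-torsion of K^* (and, for p = 2, the two extra hypotheses)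
   nothing about fields is used.
   A norm pair says (X - d) alpha = sum_j p^j delta_j together with a condition
   on norms.  Multiplying by the twisted norm
   T_k = sum_{l < p^k} X^l d^(p^k - 1 - l), for which (X - d) T_k = X^(p^k) - d^(p^k),
   shows: if p^r divides d^(p^n) - 1 and r + a_j <= n + j for all j, then
     z = ((d^(p^n) - 1) / p^r) alpha + sum_j (p^j / p^r) T_n delta_j
   makes sense, and z is a primitive p^r-th root of unity with sigma z = z^d.
   For a minimal pair this applies up to r = min(m, nu).  Indeed, if equality
   r + a_i = n + i holds while K contains p^(r+1)-th roots of unity, then the
   norm of delta_i from K_(a_i) to F is a p-th power, so delta_i can be replaced
   by an element of K_(a_i - 1) at the cost of changing alpha and delta_(i+1),
   which gives a lexicographically smaller pair.  This yields (3).
   Conversely, if nu < m, then r = nu cannot be exceeded, so some equality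
   nu + a_i = n + i holds (or nu is the valuation of d^(p^n) - 1), and it lets
   p^nu alpha be absorbed in delta_i; hence d may be changed modulo p^nu, which
   gives (1) and, taking d = 1, (2). *)

(* The square-zero extension R (+) V turns linear identities in the module V
   into identities of a commutative ring, which the ring tactic decides. *)
Definition sqzero (R : comNzRingType) (V : lmodType R) : Type := (R * V)%type.

Section SquareZero.
Context (R : comNzRingType) (V : lmodType R).
Local Notation E := (sqzero V).

HB.instance Definition _ := GRing.Zmodule.copy E (R * V)%type.

Definition sqzero_one : E := (1, 0).
Definition sqzero_mul (x y : E) : E := (x.1 * y.1, x.1 *: y.2 + y.1 *: x.2).

Fact sqzero_mulA : associative sqzero_mul.
Proof.
move=> [a u] [b v] [c w]; rewrite /sqzero_mul /=; congr pair; first by rewrite mulrA.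
by rewrite !scalerDr !scalerA -addrA (mulrC c a) (mulrC c b).
Qed.

Fact sqzero_mulC : commutative sqzero_mul.
Proof.
by move=> [a u] [b v]; rewrite /sqzero_mul /= mulrC [in RHS]addrC.
Qed.

Fact sqzero_mul1 : left_id sqzero_one sqzero_mul.
Proof. by move=> [a u]; rewrite /sqzero_mul /= mul1r scale1r scaler0 addr0. Qed.

Fact sqzero_mulDl : left_distributive sqzero_mul +%R.
Proof.
move=> [a u] [b v] [c w]; rewrite /sqzero_mul /=; congr pair.
  by rewrite mulrDl.
by rewrite scalerDl scalerDr addrACA.
Qed.

Fact sqzero_one_neq0 : sqzero_one != 0.
Proof. by apply/eqP=> -[] /eqP; rewrite oner_eq0. Qed.

HB.instance Definition _ := GRing.Zmodule_isComNzRing.Build E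
  sqzero_mulA sqzero_mulC sqzero_mul1 sqzero_mulDl sqzero_one_neq0.

Definition sqcoef (a : R) : E := (a, 0).
Definition sqvec (v : V) : E := (0, v).

Fact sqcoef_zmod : zmod_morphism sqcoef.
Proof. by move=> a b; rewrite /sqcoef; congr pair; rewrite /= ?subr0. Qed.
Fact sqcoef_monoid : monoid_morphism sqcoef.
Proof.
by split=> // a b; rewrite /sqcoef; congr pair; rewrite /= !scaler0 addr0.
Qed.
HB.instance Definition _ := GRing.isZmodMorphism.Build R E sqcoef sqcoef_zmod.
HB.instance Definition _ := GRing.isMonoidMorphism.Build R E sqcoef sqcoef_monoid.

Lemma sqvec_inj : injective sqvec. Proof. by move=> u v []. Qed.
Lemma sqvecD u v : sqvec (u + v) = sqvec u + sqvec v.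
Proof. by rewrite /sqvec; congr pair; rewrite /= addr0. Qed.
Lemma sqvecN u : sqvec (- u) = - sqvec u.
Proof. by rewrite /sqvec; congr pair; rewrite /= oppr0. Qed.
Lemma sqvec0 : sqvec 0 = 0. Proof. by []. Qed.
Lemma sqvecZ a u : sqvec (a *: u) = sqcoef a * sqvec u.
Proof. by rewrite /sqvec /sqcoef; congr pair; rewrite /= ?mulr0 // scale0r addr0. Qed.
End SquareZero.

Lemma intrX (A : pzRingType) (c : int) k : (c ^+ k)%:~R = c%:~R ^+ k :> A.
Proof. exact: (rmorphXn intr). Qed.
Lemma intrB (A : pzRingType) (a b : int) : (a - b)%:~R = a%:~R - b%:~R :> A.
Proof. exact: (rmorphB intr). Qed.
Lemma intrN (A : pzRingType) (a : int) : (- a)%:~R = - a%:~R :> A.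
Proof. exact: (rmorphN intr). Qed.
Lemma intr_nat (A : pzRingType) (k : nat) : (k%:Z)%:~R = k%:R :> A.
Proof. by []. Qed.

Ltac zring := rewrite ?(intrD, intrB, intrN, intrM, intrX, intr_nat); ring.
Ltac lmod := apply: sqvec_inj; rewrite ?(sqvecD, sqvecN, sqvecZ, sqvec0); zring.

(** Separates two kinds of reasoning: [lmod] checks u - v = w as a formal identity, and w vanishes
    by hypotheses that [ring] cannot see. *)
Lemma lincomb0 (V : zmodType) (u v w : V) : u - v = w -> w = 0 -> u = v.
Proof. by move=> <- /eqP; rewrite subr_eq0 => /eqP. Qed.

(** * Geometric sums *)

Definition geom (A : comNzRingType) (N : nat) (x : A) : A := \sum_(i < N) x ^+ i.
Definition homsum (A : comNzRingType) (N : nat) (x y : A) : A :=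
  \sum_(i < N) x ^+ (N.-1 - i) * y ^+ i.

Section GeometricSums.
Context (A : comNzRingType).
Implicit Types (x y : A) (N : nat).

Lemma geomE N x : x ^+ N - 1 = (x - 1) * geom N x.
Proof. exact: subrX1. Qed.

Lemma homsumE N x y : x ^+ N - y ^+ N = (x - y) * homsum N x y.
Proof. exact: subrXX. Qed.

Lemma geomD M N x : geom (M + N) x = geom M x + x ^+ M * geom N x.
Proof.
rewrite /geom big_split_ord /= big_distrr /=; congr (_ + _).
by apply: eq_bigr => i _; rewrite exprD.
Qed.

Lemma geom0 x : geom 0 x = 0. Proof. by rewrite /geom big_ord0. Qed.
Lemma geom1 x : geom 1 x = 1. Proof. by rewrite /geom big_ord1 expr0. Qed.

Lemma geomM M N x : geom (M * N) x = geom M x * geom N (x ^+ M).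
Proof.
elim: N => [|N IH]; first by rewrite muln0 !geom0 mulr0.
by rewrite mulnS addnC geomD IH -(addn1 N) geomD mulrDr -exprM geom1; ring.
Qed.

Lemma geomS N x : geom N.+1 x = geom N x + x ^+ N.
Proof. by rewrite /geom big_ord_recr. Qed.

Lemma homsum_geom N x : homsum N 1 x = geom N x.
Proof. by apply: eq_bigr => i _; rewrite expr1n mul1r. Qed.

(* The quotient by P of the error made when y = 1 + P * e is replaced by 1. *)
Definition homsum_err N x y e : A := \sum_(i < N) x ^+ (N.-1 - i) * (e * geom i y).

Lemma homsum_errE P N x y e :
  y = 1 + P * e -> homsum N x y = geom N x + P * homsum_err N x y e.
Proof.
move=> Dy; rewrite /homsum /homsum_err /geom (reindex_inj rev_ord_inj) /=.
rewrite [in X in P * X](reindex_inj rev_ord_inj) /= big_distrr -big_split /=.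
apply: eq_bigr => i _; have iN := ltn_ord i.
have -> : (N.-1 - (N - i.+1) = i)%N by lia.
have -> : y ^+ (N - i.+1) = 1 + P * e * geom (N - i.+1) y.
  have Dy1 : y - 1 = P * e by rewrite Dy; ring.
  by rewrite -Dy1 -geomE; ring.
by rewrite -/(geom _ y); ring.
Qed.
End GeometricSums.

Lemma geom_morph (A B : comNzRingType) (f : {rmorphism A -> B}) N x :
  f (geom N x) = geom N (f x).
Proof. by rewrite rmorph_sum; apply: eq_bigr => i _; rewrite rmorphXn. Qed.

Lemma homsum_morph (A B : comNzRingType) (f : {rmorphism A -> B}) N x y :
  f (homsum N x y) = homsum N (f x) (f y).
Proof. by rewrite rmorph_sum; apply: eq_bigr => i _; rewrite rmorphM !rmorphXn. Qed.

Lemma homsum_err_morph (A B : comNzRingType) (f : {rmorphism A -> B}) N x y e :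
  f (homsum_err N x y e) = homsum_err N (f x) (f y) (f e).
Proof.
rewrite rmorph_sum; apply: eq_bigr => i _.
by rewrite !rmorphM rmorphXn geom_morph.
Qed.

(** After multiplication by X - d both sides equal X^(M N) - d^(M N), and X - d can be cancelled in
    the domain Z[X]. *)
Lemma homsumM (d : int) (M N : nat) :
  homsum (M * N) ('X : {poly int}) d%:~R
  = homsum M 'X d%:~R * homsum N ('X ^+ M) (d%:~R ^+ M).
Proof.
have nz : ('X - d%:~R : {poly int}) != 0.
  by rewrite -(rmorph_int (@polyC int)) intz polyXsubC_eq0.
by apply: (mulfI nz); rewrite mulrA -!homsumE -!exprM.
Qed.

Lemma PoszX (p k : nat) : (p ^ k)%N%:Z = p%:Z ^+ k.
Proof. by rewrite -natz natrX natz. Qed.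

(** * Divisibility by powers of p of geometric sums and differences of powers *)

Section Integers.
Context (p : nat) (p_pr : prime p).
Implicit Types (c d x : int) (k r : nat).

Lemma dvdz_geom_sub N d : (p%:Z %| d - 1)%Z -> (p%:Z %| geom N d - N%:R)%Z.
Proof.
move=> pd; elim: N => [|N IH]; first by rewrite geom0 subrr.
have -> : geom N.+1 d - N.+1%:R = geom N d - N%:R + (d ^+ N - 1).
  by rewrite geomS; ring.
by rewrite rpredD // geomE dvdz_mulr.
Qed.

Lemma dvdz_expn_geom k d : (p%:Z %| d - 1)%Z -> (p%:Z ^+ k %| geom (p ^ k) d)%Z.
Proof.
move=> pd; elim: k => [|k IH]; first by rewrite expr0 dvd1z.
rewrite expnS mulnC geomM exprSr dvdz_mul //.
have pdk : (p%:Z %| d ^+ (p ^ k) - 1)%Z by rewrite geomE dvdz_mulr.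
by rewrite -(subrK p%:R (geom p _)) rpredD ?dvdz_geom_sub // natz dvdzz.
Qed.

(** With d = 1 + p e the sum is p plus p e times a sum that is C(p,2) = 0 mod p for odd p. For p = 2
    it is 1 + d, and d = 3 mod 4 would make u even. *)
Lemma geom_prime_unit d :
  (p%:Z %| d - 1)%Z -> (p = 2%N -> (4 %| d - 1)%Z) ->
  exists2 u, geom p d = p%:Z * u & (p%:Z %| u - 1)%Z.
Proof.
move=> pd d4; have [p2|pn2] := eqVneq p 2%N.
  have /dvdzP[e De] := d4 p2; exists (1 + 2 * e).
    have -> : d = 1 + e * 4 by rewrite -De; ring.
    by rewrite p2 /geom !big_ord_recr big_ord0 /=; ring.
  by rewrite p2; apply/dvdzP; exists e; ring.
have /dvdzP[e De] := pd.
have Dd : d = 1 + p%:Z * e by move: De; lia.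
have := @homsum_errE _ p%:Z p 1 d e Dd; rewrite homsum_geom => ->.
exists (1 + homsum_err p 1 d e).
  by rewrite /geom (eq_bigr (fun=> 1)) => [|i _]; rewrite ?expr1n // sumr_const card_ord natz; ring.
rewrite addrAC subrr add0r /homsum_err.
rewrite (eq_bigr (fun i : 'I_p => e * geom i d)) => [|i _]; last by rewrite expr1n mul1r.
rewrite -big_distrr /= dvdz_mull //.
have -> : \sum_(i < p) geom i d = \sum_(i < p) (geom i d - i%:R) + \sum_(i < p) i%:R.
  by rewrite -big_split /=; apply: eq_bigr => i _; ring.
rewrite rpredD //; first by apply: rpred_sum => i _; exact: dvdz_geom_sub.
rewrite -natr_sum natz -(big_mkord xpredT id) bin2_sum /=.
by apply: prime_dvd_bin => //; have := prime_gt1 p_pr; lia.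
Qed.

Lemma geom_expn_unit k d :
  (p%:Z %| d - 1)%Z -> (p = 2%N -> (4 %| d - 1)%Z) ->
  exists2 u, geom (p ^ k) d = p%:Z ^+ k * u & (p%:Z %| u - 1)%Z.
Proof.
move=> pd d4; elim: k => [|k [u Du pu]]; first by exists 1; rewrite ?geom1 ?expr0 ?mulr1.
have [||v Dv pv] := @geom_prime_unit (d ^+ (p ^ k)).
- by rewrite geomE dvdz_mulr.
- by move=> /d4 d4'; rewrite geomE dvdz_mulr.
exists (u * v); first by rewrite expnS mulnC geomM Du Dv exprSr; ring.
have -> : u * v - 1 = (u - 1) * v + (v - 1) by ring.
by rewrite rpredD // dvdz_mulr.
Qed.

(** C(p^k,2) is half of p^k (p^k - 1). The only failure would be C(2,2) = 1, which the hypothesis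
    for p = 2 excludes. *)
Lemma dvd_triangular_expn a k : (0 < k)%N -> (p = 2%N -> (0 < a)%N || (1 < k)%N) ->
  (p %| p ^ a * 'C(p ^ k, 2))%N.
Proof.
move=> k0; case: a => [|a] h; last by rewrite dvdn_mulr // expnS dvdn_mulr.
rewrite mul1n; have D2 : ('C(p ^ k, 2) * 2 = p ^ k * (p ^ k).-1)%N.
  rewrite bin2 muln2 halfK; suff -> : odd (p ^ k * (p ^ k).-1) = false by rewrite subn0.
  by case: (p ^ k)%N => // N; rewrite oddM /=; case: (odd N).
have [p2|pn2] := eqVneq p 2%N.
  have {h} k1 : (1 < k)%N by have := h p2.
  have : (2 * 2 %| 'C(p ^ k, 2) * 2)%N.
    by rewrite D2 dvdn_mulr // p2 -(subnKC k1) expnD dvdn_mulr.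
  by rewrite dvdn_pmul2r // p2.
have : (p %| 'C(p ^ k, 2) * 2)%N by rewrite D2 dvdn_mulr // -(prednK k0) expnS dvdn_mulr.
by rewrite Gauss_dvdl // prime_coprime // dvdn_prime2.
Qed.

(** Each p-th power gains one factor p: for x = y mod p, the cofactor of x - y in x^p - y^p is p
    y^(p-1) mod p. *)
Lemma dvdz_expn_sub c d r k :
  (0 < r)%N -> (p%:Z ^+ r %| c - d)%Z -> (p%:Z ^+ (r + k) %| c ^+ (p ^ k) - d ^+ (p ^ k))%Z.
Proof.
move=> r0 pcd; elim: k => [|k IH]; first by rewrite addn0 !expr1.
rewrite expnS mulnC !exprM homsumE addnS exprSr dvdz_mul //.
move: IH; set x := c ^+ _; set y := d ^+ _ => IH.
have pxy : (p%:Z %| x - y)%Z.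
  by apply: dvdz_trans IH; rewrite -[X in (X %| _)%Z]expr1 dvdz_exp2l //; lia.
have -> : homsum p x y = \sum_(i < p) (x ^+ (p.-1 - i) - y ^+ (p.-1 - i)) * y ^+ i
    + p%:Z * y ^+ p.-1.
  have -> : p%:Z * y ^+ p.-1 = \sum_(i < p) y ^+ p.-1.
    by rewrite sumr_const card_ord -mulr_natl natz.
  rewrite -big_split; apply: eq_bigr => i _ /=.
  have -> : y ^+ p.-1 = y ^+ (p.-1 - i) * y ^+ i.
    by rewrite -exprD subnK // -ltnS prednK ?prime_gt0.
  by ring.
rewrite rpredD ?dvdz_mulr //.
apply: rpred_sum => i _.
by rewrite homsumE -mulrA dvdz_mulr.
Qed.
End Integers.

Section FixedVectors.
Context (V : lmodType {poly int}).
Implicit Types (x y q : {poly int}) (v : V).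

Lemma fixX x k v : x *: v = v -> x ^+ k *: v = v.
Proof. by move=> xv; elim: k => [|k IH]; rewrite ?scale1r // exprS -scalerA IH. Qed.

Lemma fixZ x q v : x *: v = v -> x *: (q *: v) = q *: v.
Proof. by move=> xv; rewrite scalerA mulrC -scalerA xv. Qed.

Lemma fixD x v w : x *: v = v -> x *: w = w -> x *: (v + w) = v + w.
Proof. by move=> xv xw; rewrite scalerDr xv xw. Qed.

Lemma fix_geom N x v : x *: v = v -> geom N x *: v = N%:R *: v.
Proof.
move=> xv; rewrite /geom scaler_suml (eq_bigr (fun=> v)) => [|i _]; last exact: fixX.
by rewrite sumr_const card_ord scaler_nat.
Qed.

Lemma fix_homsum N x y v : x *: v = v -> homsum N x y *: v = geom N y *: v.
Proof.
move=> xv; rewrite /homsum /geom !scaler_suml; apply: eq_bigr => i _.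
by rewrite mulrC -scalerA (fixX _ xv).
Qed.

Lemma fix_homsum_err N x y e v :
  x *: v = v -> homsum_err N x y e *: v = homsum_err N 1 y e *: v.
Proof.
move=> xv; rewrite /homsum_err !scaler_suml; apply: eq_bigr => i _.
by rewrite expr1n mul1r [x ^+ _ * _]mulrC -[LHS]scalerA (fixX _ xv).
Qed.
End FixedVectors.

(** * Norm pairs in a Z[X]-module *)

Section ZXmodule.
Context (p n : nat) (V : lmodType {poly int}) (xi : V).
Hypotheses (p_pr : prime p) (n_gt0 : (0 < n)%N).

Local Notation P := (p%:R : {poly int}).
Local Notation Z c := (c%:~R : {poly int}).
Local Notation N a := (geom (p ^ a) 'X : {poly int}).
Local Notation T d a := (homsum (p ^ a) 'X (Z d) : {poly int}).
(* Membership in K_a. *)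
Definition fixed a (v : V) := 'X ^+ (p ^ a) *: v = v.

Hypothesis Xn : forall v : V, 'X ^+ (p ^ n) *: v = v.
Hypothesis hilbert90 : forall a v, (a <= n)%N ->
  geom (p ^ (n - a)) ('X ^+ (p ^ a)) *: v = 0 ->
  exists w : V, v = ('X ^+ (p ^ a) - 1) *: w.
Hypotheses (xi_neq0 : xi != 0) (Xxi : 'X *: xi = xi) (Pxi : P *: xi = 0).
Hypothesis torsion : forall v : V, P *: v = 0 -> exists k : int, v = Z k *: xi.

Fact P_neq0 : P != 0.
Proof.
by rewrite -polyC_natr polyC_eq0 natz; have := prime_gt0 p_pr; case: (p).
Qed.

Lemma fixed_leq a b v : (a <= b)%N -> fixed a v -> fixed b v.
Proof. by move=> ab fv; rewrite /fixed -(subnKC ab) expnD exprM; apply: fixX. Qed.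

Lemma normM a b : (a <= b)%N -> N b = N a * geom (p ^ (b - a)) ('X ^+ (p ^ a)).
Proof. by move=> ab; rewrite -geomM -expnD subnKC. Qed.

Lemma norm_fixed a b v : (a <= b)%N -> fixed a v -> N b *: v = P ^+ (b - a) *: (N a *: v).
Proof.
by move=> ab fv; rewrite (normM ab) -scalerA (fix_geom _ fv) natrX !scalerA mulrC.
Qed.

(** q - q(1) is a multiple of X - 1, and (X - 1) N_k = X^(p^k) - 1 kills the elements of K_k. *)
Lemma norm_eval k q v : fixed k v -> N k *: (q *: v) = Z q.[1] *: (N k *: v).
Proof.
move=> fv; have /factor_theorem[r Dr] : root (q - q.[1]%:P) 1.
  by rewrite rootE !hornerE subrr.
have {}Dr : q = r * ('X - 1) + Z q.[1].
  by rewrite -(rmorph_int (@polyC int)) intz -Dr subrK.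
rewrite {1}Dr; set c := q.[1].
have -> : N k *: ((r * ('X - 1) + Z c) *: v) = r *: (('X - 1) * N k *: v) + Z c *: (N k *: v).
  by lmod.
by rewrite -geomE scalerBl scale1r [_ *: v]fv subrr scaler0 add0r.
Qed.

(** * Torsion of p-power order *)

Lemma torsion_dvd c : Z c *: xi = 0 -> (p%:Z %| c)%Z.
Proof.
move=> cxi; apply/negPn/negP => npc.
have /coprimezP[[u v] /= uv] : coprimez p%:Z c.
  by rewrite coprimezE prime_coprime.
move/eqP: xi_neq0; apply; rewrite -(scale1r xi).
have -> : 1 = Z u * P + Z v * Z c by rewrite -[LHS](rmorph1 intr) -uv; ring.
by rewrite scalerDl -!scalerA cxi Pxi !scaler0 addr0.
Qed.

Lemma root_order r (y : V) c :
  P ^+ r *: y = xi -> Z c *: y = 0 -> (p%:Z ^+ r.+1 %| c)%Z.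
Proof.
elim: r y c => [|r IH] y c.
  by rewrite expr0 scale1r => -> /torsion_dvd; rewrite expr1.
move=> Dxi cy; have /dvdzP[c' Dc] : (p%:Z %| c)%Z.
  by apply: torsion_dvd; rewrite -Dxi scalerA mulrC -scalerA cy scaler0.
rewrite Dc exprSr dvdz_mul // (IH (P *: y)) //; first by rewrite scalerA -exprSr.
by rewrite scalerA -cy Dc; congr (_ *: _); ring.
Qed.

Lemma root_generates r (y w : V) :
  P ^+ r *: y = xi -> P ^+ r.+1 *: w = 0 -> exists k : int, w = Z k *: y.
Proof.
elim: r y w => [|r IH] y w; first by rewrite expr0 scale1r => ->; apply: torsion.
move=> Dxi w0; have [||k Dk] := IH (P *: y) (P *: w).
- by rewrite scalerA -exprSr.
- by rewrite scalerA -exprSr.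
have [|l Dl] := torsion (v := w - Z k *: y).
  by apply: lincomb0 (_ : _ = P *: w - Z k *: (P *: y)) _; [lmod | rewrite Dk subrr].
exists (k + l * p%:Z ^+ r.+1); rewrite -(subrK (Z k *: y) w) Dl -Dxi; lmod.
Qed.

(* For delta = (delta_0, .., delta_m), the additive forms of prod_j delta_j^(p^j)
   and of N_(K_(n-1)/F)(delta_0) prod_(j >= 1) N_(K/F)(delta_j)^(p^(j-1)). *)
Definition weighted m (delta : nat -> V) := \sum_(i < m.+1) P ^+ i *: delta i.
Definition weighted_norm m (delta : nat -> V) :=
  N n.-1 *: delta 0 + \sum_(i < m) P ^+ i *: (N n *: delta i.+1).
Definition at_index (i : nat) (v : V) (j : nat) := if j == i then v else 0.

Lemma weightedD m f g : weighted m (f \+ g) = weighted m f + weighted m g.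
Proof. by rewrite /weighted -big_split; apply: eq_bigr => i _ /=; lmod. Qed.

Lemma weightedZ m q f : weighted m (q \*: f) = q *: weighted m f.
Proof. by rewrite /weighted scaler_sumr; apply: eq_bigr => i _ /=; lmod. Qed.

Lemma weighted_normD m f g :
  weighted_norm m (f \+ g) = weighted_norm m f + weighted_norm m g.
Proof.
rewrite /weighted_norm addrACA -big_split /=; congr (_ + _); first lmod.
by apply: eq_bigr => i _ /=; lmod.
Qed.

Lemma weighted_normZ m q f : weighted_norm m (q \*: f) = q *: weighted_norm m f.
Proof.
rewrite /weighted_norm [in RHS]scalerDr scaler_sumr /=; congr (_ + _); first lmod.
by apply: eq_bigr => i _ /=; lmod.
Qed.

Lemma weighted_at m i v : (i <= m)%N -> weighted m (at_index i v) = P ^+ i *: v.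
Proof.
move=> im; rewrite /weighted (bigD1 (Ordinal (im : (i < m.+1)%N))) //= /at_index eqxx.
rewrite big1 ?addr0 // => j; rewrite -val_eqE /= => /negPf->.
by rewrite scaler0.
Qed.

Lemma weighted_norm_at0 m v : weighted_norm m (at_index 0 v) = N n.-1 *: v.
Proof. by rewrite /weighted_norm big1 ?addr0 // => i _; rewrite !scaler0. Qed.

Lemma weighted_norm_atS m i v :
  (i < m)%N -> weighted_norm m (at_index i.+1 v) = P ^+ i *: (N n *: v).
Proof.
move=> im; rewrite /weighted_norm scaler0 add0r (bigD1 (Ordinal im)) //= /at_index eqxx.
rewrite big1 ?addr0 // => j; rewrite -val_eqE /= eqSS => /negPf->.
by rewrite !scaler0.
Qed.

(** * Twisted norms, and the root of unity attached to a norm pair *)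

Section TwistedNorm.
Context (d e : int).
Hypothesis Dd : d = 1 + p%:Z * e.

(** This is (d^(p^n) - 1) / (d^(p^k) - 1), written as a sum so that it also makes sense when d^(p^k)
    = 1. *)
Definition index_sum k : int := geom (p ^ (n - k)) (d ^+ (p ^ k)).
(** The quotient (T_n - N_n) / p, taken in Z[X] because division by p in V is not unique. *)
Definition twist_err : {poly int} := homsum_err (p ^ n) 'X (Z d) (Z e).

Fact ZD : Z d = 1 + P * Z e. Proof. by rewrite Dd; zring. Qed.

Lemma index_sumE k : (k <= n)%N -> index_sum k * (d ^+ (p ^ k) - 1) = d ^+ (p ^ n) - 1.
Proof. by move=> kn; rewrite mulrC -geomE -exprM -expnD subnKC. Qed.

Lemma dvd_index_sum k : (p%:Z ^+ (n - k) %| index_sum k)%Z.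
Proof.
by apply: dvdz_expn_geom; rewrite geomE Dd dvdz_mulr // addrAC subrr add0r dvdz_mulr.
Qed.

Lemma twisted_normE : T d n = N n + P * twist_err.
Proof. exact: homsum_errE ZD. Qed.

Lemma twisted_normM k : (k <= n)%N ->
  T d n = T d k * homsum (p ^ (n - k)) ('X ^+ (p ^ k)) (Z d ^+ (p ^ k)).
Proof. by move=> kn; rewrite -homsumM -expnD subnKC. Qed.

Lemma twisted_norm_fixed k v : (k <= n)%N -> fixed k v ->
  T d n *: v = Z (index_sum k) *: (T d k *: v).
Proof.
move=> kn fv; rewrite (twisted_normM kn) -scalerA (fix_homsum _ _ fv).
by rewrite /index_sum (geom_morph intr) /= intrX !scalerA mulrC.
Qed.

(** On K_k the product (X - d) T_k = X^(p^k) - d^(p^k) is the scalar 1 - d^(p^k), and [index_sumE]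
    turns c times this scalar into - q p^j. *)
Lemma beta_twist k v R j c q : (k <= n)%N -> fixed k v ->
  p%:Z ^+ R * c = p%:Z ^+ j * index_sum k -> p%:Z ^+ R * q = d ^+ (p ^ n) - 1 ->
  ('X - Z d) *: (Z c *: (T d k *: v)) = - (Z q * P ^+ j) *: v.
Proof.
move=> kn fv Dc Dq.
have pR : p%:Z ^+ R != 0 by rewrite expf_neq0 // -lt0n prime_gt0.
have Ec : c * (1 - d ^+ (p ^ k)) = - (q * p%:Z ^+ j).
  by apply: (mulfI pR); rewrite mulrA Dc mulrN mulrA Dq -(index_sumE kn); ring.
have -> : ('X - Z d) *: (Z c *: (T d k *: v)) = Z c *: ((('X - Z d) * T d k) *: v).
  by lmod.
rewrite -homsumE scalerBl fv; transitivity (Z (c * (1 - d ^+ (p ^ k))) *: v); first lmod.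
by rewrite Ec; lmod.
Qed.

Lemma beta_normS k v R j c : (k <= n)%N -> fixed k v ->
  p%:Z ^+ R.+1 * c = p%:Z ^+ j.+1 * index_sum k ->
  P ^+ R *: (Z c *: (T d k *: v)) = P ^+ j *: (T d n *: v).
Proof.
move=> kn fv Dc; rewrite (twisted_norm_fixed kn fv).
have p0 : p%:Z != 0 by rewrite -lt0n prime_gt0.
have Ec : p%:Z ^+ R * c = p%:Z ^+ j * index_sum k.
  by apply: (mulfI p0); rewrite !mulrA -!exprS.
transitivity (Z (p%:Z ^+ R * c) *: (T d k *: v)); first lmod.
by rewrite Ec; lmod.
Qed.

(** The right side stands for T_n v / p. The factor p cannot be cancelled in V, which has p-torsion,
    so it is cancelled in Z and in Z[X] before acting on v. *)
Lemma beta_norm0 k v R c : (k < n)%N -> fixed k v ->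
  p%:Z ^+ R.+1 * c = index_sum k ->
  P ^+ R *: (Z c *: (T d k *: v)) = N n.-1 *: v + twist_err *: v.
Proof.
move=> kn fv Dc; have kn' := ltnW kn.
have p0 : p%:Z != 0 by rewrite -lt0n prime_gt0.
pose e' := e * geom (p ^ k) d.
have De' : d ^+ (p ^ k) = 1 + p%:Z * e'.
  have Dd1 : d - 1 = p%:Z * e by rewrite Dd; ring.
  by rewrite /e' mulrA -Dd1 -geomE; ring.
pose y0 := homsum_err (p ^ (n - k)) 1 (d ^+ (p ^ k)) e'.
have DS : index_sum k = p%:Z * (p%:Z ^+ (n.-1 - k) + y0).
  have := homsum_errE (p ^ (n - k)) 1 De'; rewrite homsum_geom -/(index_sum k) => ->.
  rewrite /geom (eq_bigr (fun=> 1)) => [|i _]; last by rewrite expr1n.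
  rewrite sumr_const card_ord natrX natz mulrDr -exprS.
  by have -> : ((n.-1 - k).+1 = n - k)%N by lia.
have Ec : p%:Z ^+ R * c = p%:Z ^+ (n.-1 - k) + y0.
  by apply: (mulfI p0); rewrite mulrA -exprS Dc DS.
pose H : {poly int} := homsum (p ^ (n - k)) ('X ^+ (p ^ k)) (Z d ^+ (p ^ k)).
pose Y : {poly int} := homsum_err (p ^ (n - k)) ('X ^+ (p ^ k)) (Z d ^+ (p ^ k)) (Z e').
pose U : {poly int} := homsum_err (p ^ k) 'X (Z d) (Z e).
have DT : T d k = N k + P * U by apply: homsum_errE ZD.
have DH : H = geom (p ^ (n - k)) ('X ^+ (p ^ k)) + P * Y.
  by apply: homsum_errE; rewrite -intrX De'; zring.
have DW : twist_err = N k * Y + U * H.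
  apply: (mulfI P_neq0); apply: (addrI (N n)).
  rewrite -twisted_normE (twisted_normM kn') -/H DT DH (normM kn').
  ring.
have Hv : H *: v = Z (index_sum k) *: v.
  by rewrite (fix_homsum _ _ fv) /index_sum (geom_morph intr) /= intrX.
have Yv : Y *: v = Z y0 *: v.
  by rewrite (fix_homsum_err _ _ _ fv) (homsum_err_morph intr) /= intrX.
rewrite DW scalerDl -!scalerA Hv Yv (@norm_fixed k) //; last by rewrite -ltnS prednK.
transitivity (Z (p%:Z ^+ R * c) *: (T d k *: v)); first lmod.
by rewrite Ec DS DT; lmod.
Qed.

Definition entry_le (k : nat) (x : option nat) := if x is Some l then (l <= k)%N else true.

Definition valid_entries m (a : seq (option nat)) :=
  [/\ size a = m, all (entry_le n) a & olt_minf (nth None a 0) (Some n)].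

Definition fits m (a : seq (option nat)) (delta : nat -> V) := forall i, (i < m)%N ->
  if nth None a i is Some k then fixed k (delta i) else delta i = 0.

(* The paper's condition is the case u = 1; a u prime to p is scaled away by
   norm_pair_scale. *)
Definition norm_rep m a (u : int) (alpha : V) delta :=
  [/\ fits m a delta, ('X - Z d) *: alpha = weighted m delta
    & Z e *: (N n *: alpha) + weighted_norm m delta = Z u *: xi].

(** Plays the role of p^j T_n v / p. For j = 0 the quotient is N_(n-1) + [twist_err], since N_n = p
    N_(n-1) on K_(n-1). *)
Definition term_norm j (v : V) :=
  if j is i.+1 then P ^+ i *: (T d n *: v) else N n.-1 *: v + twist_err *: v.

Lemma valid_entries_le m a j k : valid_entries m a -> nth None a j = Some k -> (k <= n)%N.
Proof.
case=> sz /allP an _ aj; have := an (Some k); apply; rewrite -aj mem_nth //.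
by case: ltnP => // /(nth_default None); rewrite aj.
Qed.

(** The witness is c T_k v with c = p^j [index_sum k] / p^(R+1), an integer because p^(n-k) divides
    [index_sum k] and R + 1 + k <= n + j. *)
Lemma beta_exists_fixed k R j q v :
  (k <= n)%N -> (j = 0 -> k < n)%N -> fixed k v -> (R.+1 + k <= n + j)%N ->
  p%:Z ^+ R.+1 * q = d ^+ (p ^ n) - 1 ->
  exists b, ('X - Z d) *: b = - (Z q * P ^+ j) *: v /\ P ^+ R *: b = term_norm j v.
Proof.
move=> kn kn0 fv Rk Dq; have /dvdzP[s Ds] := dvd_index_sum k.
pose c := s * p%:Z ^+ (n - k + j - R.+1).
have Dc : p%:Z ^+ R.+1 * c = p%:Z ^+ j * index_sum k.
  by rewrite mulrCA -exprD Ds mulrCA -exprD; congr (_ * _ ^+ _); lia.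
exists (Z c *: (T d k *: v)); split; first exact: beta_twist Dc Dq.
case: j kn0 Rk @c Dc => [|j] kn0 Rk c Dc; last exact: beta_normS Dc.
by apply: beta_norm0; rewrite ?kn0 // Dc expr0 mul1r.
Qed.

Lemma beta_exists m a R q delta j : valid_entries m a -> fits m a delta -> (0 < m)%N ->
  (j < m.+1)%N -> (R < m)%N ->
  (forall k, (j < m)%N -> nth None a j = Some k -> (R.+1 + k <= n + j)%N) ->
  p%:Z ^+ R.+1 * q = d ^+ (p ^ n) - 1 ->
  exists b, ('X - Z d) *: b = - (Z q * P ^+ j) *: delta j /\
            P ^+ R *: b = term_norm j (delta j).
Proof.
move=> sha fit m0; rewrite ltnS leq_eqVlt => /orP[/eqP-> | jm] Rm Rk Dq.
  apply: (@beta_exists_fixed n) => //; [by move=> m00; rewrite m00 in m0 | by lia].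
have := fit j jm; case Daj: (nth None a j) => [k|] => [fv | ->].
  apply: (@beta_exists_fixed k) => //; [exact: valid_entries_le sha Daj | | exact: Rk].
  by move=> j0; case: sha => _ _; rewrite -j0 Daj.
exists 0; rewrite !scaler0; split=> //.
by case: (j) => [|i]; rewrite /= !scaler0 ?addr0.
Qed.

(** The selection I will be either all indices or all but the one whose entry is to be lowered. *)
Lemma beta_sum m a R q delta (I : pred nat) :
  valid_entries m a -> fits m a delta -> (0 < m)%N -> (R < m)%N ->
  (forall j k, (j < m)%N -> I j -> nth None a j = Some k -> (R.+1 + k <= n + j)%N) ->
  p%:Z ^+ R.+1 * q = d ^+ (p ^ n) - 1 ->
  exists b, ('X - Z d) *: b = - Z q *: (\sum_(j < m.+1 | I j) P ^+ j *: delta j) /\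
            P ^+ R *: b = \sum_(j < m.+1 | I j) term_norm j (delta j).
Proof.
move=> sha fit m0 Rm Rk Dq.
have /fin_all_exists[b Hb] (j : 'I_m.+1) : exists b, I j ->
    ('X - Z d) *: b = - (Z q * P ^+ j) *: delta j /\ P ^+ R *: b = term_norm j (delta j).
  have [Ij|] := boolP (I j); last by exists 0.
  have [k jm|b Hb] := @beta_exists m a R q delta j sha fit m0 (ltn_ord j) Rm _ Dq.
    by apply: Rk.
  by exists b.
exists (\sum_(j < m.+1 | I j) b j); rewrite !scaler_sumr; split.
  by apply: eq_bigr => j Ij; have [-> _] := Hb j Ij; lmod.
by apply: eq_bigr => j Ij; have [_ ->] := Hb j Ij.
Qed.

(** Compares (X - d) T_n = X^(p^n) - d^(p^n) with (X - 1) N_n = X^(p^n) - 1, and cancels p in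
    Z[X]. *)
Lemma twist_errE R q : p%:Z ^+ R.+1 * q = d ^+ (p ^ n) - 1 ->
  (Z d - 'X) * twist_err = P ^+ R * Z q - Z e * N n.
Proof.
move=> Dq; apply: (mulfI P_neq0).
have -> : P * ((Z d - 'X) * twist_err)
    = - (('X - Z d) * T d n) + ('X - Z d) * N n by rewrite twisted_normE; ring.
have -> : ('X - Z d) * N n = ('X - 1) * N n - P * Z e * N n by rewrite ZD; ring.
rewrite -homsumE -geomE mulrBr [P * (P ^+ R * _)]mulrA -exprS.
have -> : P ^+ R.+1 * Z q = Z d ^+ (p ^ n) - 1.
  by rewrite -intrX -[1]/(Z 1) -intrB -Dq; zring.
by ring.
Qed.

(** The terms add up to the weighted norm plus [twist_err] applied to (X - d) alpha, which
    [twist_errE] rewrites. Thus the norm condition prescribes p^R z for the z built in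
    [norm_rep_root]. *)
Lemma norm_equation m R q alpha delta :
  p%:Z ^+ R.+1 * q = d ^+ (p ^ n) - 1 -> ('X - Z d) *: alpha = weighted m delta ->
  (P ^+ R * Z q) *: alpha + \sum_(j < m.+1) term_norm j (delta j)
  = Z e *: (N n *: alpha) + weighted_norm m delta.
Proof.
move=> Dq Dalpha.
have -> : \sum_(j < m.+1) term_norm j (delta j)
          = weighted_norm m delta + twist_err *: weighted m delta.
  rewrite /weighted_norm /weighted !big_ord_recl /= scalerDr expr0 scale1r addrACA.
  congr (_ + _); rewrite scaler_sumr -big_split; apply: eq_bigr => i _ /=.
  by rewrite twisted_normE exprS; lmod.
rewrite -Dalpha.
have -> : P ^+ R * Z q = Z e * N n + (Z d - 'X) * twist_err by rewrite (twist_errE Dq); ring.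
by lmod.
Qed.

Lemma norm_rep_root m a R q alpha delta :
  valid_entries m a -> (0 < m)%N -> (R < m)%N -> norm_rep m a 1 alpha delta ->
  (forall j k, (j < m)%N -> nth None a j = Some k -> (R.+1 + k <= n + j)%N) ->
  p%:Z ^+ R.+1 * q = d ^+ (p ^ n) - 1 ->
  exists2 z, P ^+ R *: z = xi & ('X - Z d) *: z = 0.
Proof.
move=> sha m0 Rm [fit Dalpha Dnorm] Rk Dq.
have [|b [b1 b2]] := @beta_sum m a R q delta xpredT sha fit m0 Rm _ Dq.
  by move=> j k jm _; apply: Rk.
exists (Z q *: alpha + b).
  rewrite scalerDr b2 scalerA norm_equation // Dnorm; exact: scale1r.
rewrite scalerDr b1 -/(weighted m delta) -Dalpha; lmod.
Qed.

End TwistedNorm.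

(** * Exchanges between alpha and the entries of a norm pair *)

Lemma eval_fixed q (v : V) : 'X *: v = v -> q *: v = Z q.[1] *: v.
Proof.
move=> Xv; have := @norm_eval 0 q v; rewrite expn0 geom1 !scale1r; apply.
by rewrite /fixed expn0 expr1.
Qed.

Lemma X_norm a (v : V) : fixed a v -> 'X *: (N a *: v) = N a *: v.
Proof.
move=> fv; apply: lincomb0 (_ : _ = (('X - 1) * N a) *: v) _; first by lmod.
by rewrite -geomE scalerBl fv scale1r subrr.
Qed.

(** Division by X - d of the norm from K_(b+k) to K_b: the remainder is its value p^k u at X = d.
    Putting X = 1 relates u to q(1), and q(1) = p^b C(p^k,2) mod p because d = 1 mod p. *)
Lemma quotient_norm d e b k u : d = 1 + p%:Z * e ->
  geom (p ^ k) (d ^+ (p ^ b)) = p%:Z ^+ k * u ->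
  exists q : {poly int},
    [/\ geom (p ^ k) ('X ^+ (p ^ b)) = P ^+ k * Z u + ('X - Z d) * q,
        p%:Z ^+ k * (u - 1) = p%:Z * e * q.[1]
      & (0 < k)%N -> (p = 2%N -> (0 < b)%N || (1 < k)%N) -> (p%:Z %| q.[1])%Z].
Proof.
move=> Dd Du; pose q : {poly int} := \sum_(l < p ^ k) homsum (p ^ b * l) 'X (Z d).
have Dq : geom (p ^ k) ('X ^+ (p ^ b)) = P ^+ k * Z u + ('X - Z d) * q.
  have -> : P ^+ k * Z u = geom (p ^ k) (Z d ^+ (p ^ b)).
    by rewrite -intrX -(geom_morph intr) /= Du; zring.
  rewrite big_distrr /= -big_split /=; apply: eq_bigr => l _.
  by rewrite -homsumE -!exprM; ring.
have Dq1 : q.[1] = \sum_(l < p ^ k) geom (p ^ b * l) d.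
  rewrite horner_sum; apply: eq_bigr => l _.
  rewrite -[LHS](horner_evalE 1) homsum_morph /= !horner_evalE hornerX.
  by rewrite -(rmorph_int (@polyC int)) hornerC intz homsum_geom.
exists q; split=> //.
  have := congr1 (horner_eval (1 : int)) Dq.
  rewrite (geom_morph (horner_eval (1 : int))) rmorphD !rmorphM !rmorphXn rmorphB.
  rewrite /= !horner_evalE hornerX -!(rmorph_int (@polyC int)) !hornerC !intz.
  rewrite -polyC_natr hornerC natz expr1n /geom (eq_bigr (fun=> 1)) => [|i _].
    rewrite sumr_const card_ord natrX natz Dd => E.
    have -> : p%:Z ^+ k * (u - 1)
        = (p%:Z ^+ k * u + (1 - (1 + p%:Z * e)) * q.[1]) - p%:Z ^+ k + p%:Z * e * q.[1] by ring.
    by rewrite -E subrr add0r.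
  by rewrite expr1n.
move=> k0 hp; rewrite Dq1.
have -> : \sum_(l < p ^ k) geom (p ^ b * l) d
    = \sum_(l < p ^ k) (geom (p ^ b * l) d - (p ^ b * l)%N%:R) + \sum_(l < p ^ k) (p ^ b * l)%N%:R.
  by rewrite -big_split; apply: eq_bigr => l _ /=; ring.
rewrite rpredD //; first apply: rpred_sum => l _.
  by apply: dvdz_geom_sub; rewrite Dd addrAC subrr add0r dvdz_mulr.
rewrite -natr_sum natz -big_distrr /= -(big_mkord xpredT id) bin2_sum.
exact: dvd_triangular_expn.
Qed.

Lemma geom_fixed b k v : fixed (b + k) v -> fixed b (geom (p ^ k) ('X ^+ (p ^ b)) *: v).
Proof.
move=> fv; apply: lincomb0 (_ : _ = (('X ^+ (p ^ b) - 1) * geom (p ^ k) ('X ^+ (p ^ b))) *: v) _.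
  by lmod.
by rewrite -geomE -exprM -expnD scalerBl fv scale1r subrr.
Qed.

(** Index 0 obeys the same formula as the others: N_(n-1) acts on K_b as p^(n-1-b) N_b, and N_b
    composed with the relative norm is N_(b+k). At the other indices the relative norm contributes
    p^k. *)
Lemma weighted_norm_geom m i b k v : (i <= m)%N -> (b + k <= n)%N -> (i = 0 -> 0 < k)%N ->
  fixed (b + k) v ->
  weighted_norm m (at_index i (geom (p ^ k) ('X ^+ (p ^ b)) *: v)) = P ^+ (i + k).-1 *: (N n *: v).
Proof.
move=> im bkn ik fv; have fM := geom_fixed fv.
case: i im ik => [|i] im ik.
  have k0 := ik erefl.
  rewrite weighted_norm_at0 (@norm_fixed b) //; last by lia.
  rewrite (@norm_fixed (b + k) n) // [N b *: _]scalerA.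
  have -> : N b * geom (p ^ k) ('X ^+ (p ^ b)) = N (b + k).
    by rewrite (@normM b (b + k)) ?leq_addr // addKn.
  by rewrite [RHS]scalerA -exprD; congr (_ ^+ _ *: _); lia.
rewrite weighted_norm_atS // norm_eval; last exact: Xn.
rewrite -[_.[1]](horner_evalE 1) (geom_morph (horner_eval (1 : int))) rmorphXn /=.
rewrite horner_evalE hornerX expr1n /geom (eq_bigr (fun=> 1)) => [|l _]; last by rewrite expr1n.
rewrite sumr_const card_ord natrX natz exprD; lmod.
Qed.

Definition is_norm_pair m a d := exists e alpha delta,
  [/\ d = 1 + p%:Z * e, valid_entries m a & norm_rep d e m a 1 alpha delta].

(** Multiplying alpha and all delta_j by an inverse of u modulo p preserves the linear equation and
    the fields; as p xi = 0, the right side becomes xi. *)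
Lemma norm_pair_scale m a d e u alpha delta : d = 1 + p%:Z * e -> valid_entries m a ->
  ~~ (p%:Z %| u)%Z -> norm_rep d e m a u alpha delta -> is_norm_pair m a d.
Proof.
move=> Dd sha pu [fit Da Dn].
have /coprimezP[[s t] /= st] : coprimez p%:Z u by rewrite coprimezE prime_coprime.
exists e, (Z t *: alpha), (Z t \*: delta); split=> //; split.
- move=> i im; have := fit i im; case: (nth _ _ _) => [k|] /=; first exact: fixZ.
  by move->; rewrite scaler0.
- by rewrite weightedZ -Da; lmod.
rewrite weighted_normZ; transitivity (Z t *: (Z e *: (N n *: alpha) + weighted_norm m delta)).
  by lmod.
rewrite Dn scale1r; transitivity (Z (s * p%:Z + t * u) *: xi - Z s *: (P *: xi)); first lmod.
by rewrite st Pxi scaler0 subr0 scale1r.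
Qed.

(** If d' = d + k p^j, the surplus - k p^j alpha is absorbed by delta_j, which may be any element of
    K. The change k p^(j-1) of e is cancelled by the norm of the new term. *)
Lemma norm_pair_change m a d d' j : (0 < j <= m)%N -> (j = m \/ nth None a j = Some n) ->
  (p%:Z ^+ j %| d' - d)%Z -> is_norm_pair m a d -> is_norm_pair m a d'.
Proof.
case: j => // j /= jm ja /dvdzP[k Dk] [e [alpha [delta [Dd sha [fit Da Dn]]]]].
have Dd' : d' = 1 + p%:Z * (e + k * p%:Z ^+ j).
  by rewrite -(subrK d d') Dk Dd exprS; ring.
exists (e + k * p%:Z ^+ j), alpha, (delta \+ at_index j.+1 (- (Z k *: alpha))); split=> //.
split.
- move=> i im; rewrite /= /at_index; have := fit i im.
  case: eqVneq im => [-> im|_ _]; last by rewrite addr0.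
  by case: ja => [jE | -> _]; [rewrite jE ltnn in im | exact: Xn].
- by rewrite weightedD weighted_at // -Da -(subrK d d') Dk; lmod.
rewrite weighted_normD weighted_norm_atS // -Dn; lmod.
Qed.

(* Modulo X - d, the norm from K to K_b is p^(n-b) times the unit u, so
   p^(i+k) u alpha can be traded for p^i times an element of K_b. *)
Lemma norm_pair_shift m a d i b k u e' : is_norm_pair m a d ->
  (i < m)%N -> nth None a i = Some b -> (b + k = n)%N ->
  geom (p ^ k) (d ^+ (p ^ b)) = p%:Z ^+ k * u ->
  (i = 0 -> p = 2 -> (0 < b)%N || (1 < k)%N)%N ->
  is_norm_pair m a (d + p%:Z ^+ (i + k) * u * e').
Proof.
move=> [e [alpha [delta [Dd sha [fit Da Dn]]]]] im Dai bk Du hp.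
have ik0 : (i = 0 -> 0 < k)%N by case: sha => _ _ + i0; rewrite -i0 Dai /=; lia.
have ik : (0 < i + k)%N by case: (i) ik0 => [/(_ erefl)|].
have [q [Dq qE q1]] := quotient_norm Dd Du.
set s := p%:Z ^+ (i + k).-1 * u * e'.
have Dd' : d + p%:Z ^+ (i + k) * u * e' = 1 + p%:Z * (e + s).
  by rewrite /s -[in LHS](prednK ik) exprS Dd; ring.
(* Replacing p^k u alpha by M alpha - q (X - d) alpha, with M the relative norm, multiplies every
   delta_j by f and adds - e' M alpha at index i. *)
pose f : {poly int} := 1 + Z e' * P ^+ i * q.
pose v := geom (p ^ k) ('X ^+ (p ^ b)) *: alpha.
(* The coefficient of N_n alpha left over in the new norm condition. *)
have sE : s - e * e' * p%:Z ^+ i * q.[1] - e' * p%:Z ^+ (i + k).-1 = 0.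
  have p0 : p%:Z != 0 by rewrite -lt0n prime_gt0.
  apply: (mulfI p0); rewrite mulr0.
  transitivity (e' * (p%:Z ^+ (i + k).-1.+1 * (u - 1) - p%:Z ^+ i * (p%:Z * e * q.[1]))).
    by rewrite /s exprS; ring.
  by rewrite -qE prednK // exprD; ring.
have Xxi' : q *: xi = Z q.[1] *: xi by apply: eval_fixed.
have XN : q *: (N n *: alpha) = Z q.[1] *: (N n *: alpha) by apply: eval_fixed; exact: X_norm.
apply: (@norm_pair_scale _ _ _ (e + s) (1 + e' * p%:Z ^+ i * q.[1]) alpha
          ((f \*: delta) \+ (- Z e') \*: at_index i v)) => //.
  (* On fixed vectors f acts as f(1), which must be prime to p; for i = 0 this needs p to divide
     q(1). *)
  have pe : (p%:Z %| e' * p%:Z ^+ i * q.[1])%Z.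
    have [i0|i0] := posnP i; first by rewrite dvdz_mull // q1 ?ik0 //; apply: hp.
    by rewrite -(prednK i0) exprS dvdz_mulr // dvdz_mull // dvdz_mulr.
  apply/negP => p1; have : (p%:Z %| 1%R)%Z by rewrite -(addrK (e' * p%:Z ^+ i * q.[1]) 1) rpredB.
  by rewrite dvdz1 /= gtn_eqF ?prime_gt1.
split.
- move=> j jm; have := fit j jm; rewrite /= /at_index; case: eqVneq => [->|_].
    rewrite Dai => fj; apply: fixD; first exact: fixZ.
    by apply: fixZ; apply: geom_fixed; rewrite bk; exact: Xn.
  by case: (nth _ _ _) => [l|]; rewrite scaler0 addr0; [exact: fixZ | move=> ->; rewrite scaler0].
- rewrite weightedD !weightedZ weighted_at; last exact: ltnW.
  rewrite -Da /v Dq /f -[in LHS](prednK ik) (exprS _ (i + k).-1).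
  have Pik : P ^+ (i + k).-1.+1 = P ^+ i * P ^+ k by rewrite prednK // exprD.
  apply: lincomb0 (_ : _ = (Z u * Z e' * (P ^+ i * P ^+ k - P ^+ (i + k).-1.+1)) *: alpha) _.
    by rewrite exprS; lmod.
  by rewrite Pik subrr mulr0 scale0r.
rewrite weighted_normD !weighted_normZ (weighted_norm_geom (b := b)) // ?bk // ?(ltnW im) //.
have -> : weighted_norm m delta = xi - Z e *: (N n *: alpha).
  by apply: (addrI (Z e *: (N n *: alpha))); rewrite Dn addrC subrK scale1r.
have fE (w : V) : q *: w = Z q.[1] *: w -> f *: w = (1 + Z e' * P ^+ i * Z q.[1]) *: w.
  by move=> qw; rewrite /f scalerDl -scalerA qw; lmod.
rewrite scalerBr fE // [f *: (Z e *: _)]scalerA [f * _]mulrC -scalerA fE //.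
apply: lincomb0 (_ : _ = Z (s - e * e' * p%:Z ^+ i * q.[1] - e' * p%:Z ^+ (i + k).-1)
   *: (N n *: alpha)) _; first lmod.
by rewrite sE scale0r.
Qed.

(* The same exchange moves delta_j into position i. *)
Lemma norm_pair_drop m a d i j b u : is_norm_pair m a d -> (i < j < m)%N ->
  nth None a i = Some b -> nth None a j = Some (b + (j - i))%N ->
  geom (p ^ (j - i)) (d ^+ (p ^ b)) = p%:Z ^+ (j - i) * u -> ~~ (p%:Z %| u)%Z ->
  is_norm_pair m (set_nth None a j None) d.
Proof.
move=> [e [alpha [delta [Dd sha [fit Da Dn]]]]] /andP[ij jm] Dai Daj Du pu.
set k := (j - i)%N in Daj Du.
have Dj : (j = i + k)%N by rewrite /k subnKC // ltnW.
have k0 : (0 < k)%N by rewrite subn_gt0.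
have im : (i < m)%N := ltn_trans ij jm.
have fj : fixed (b + k) (delta j) by have := fit j jm; rewrite Daj.
have bkn : (b + k <= n)%N := valid_entries_le sha Daj.
have [q [Dq qE _]] := quotient_norm Dd Du.
pose v := geom (p ^ k) ('X ^+ (p ^ b)) *: delta j.
have jj : (j.-1.+1 = j)%N by rewrite prednK // (leq_ltn_trans _ ij).
have wj w : weighted_norm m (at_index j w) = P ^+ j.-1 *: (N n *: w).
  by rewrite -{1}jj weighted_norm_atS // jj ltnW.
(* The term p^i q delta_j of the new alpha replaces p^(i+k) u delta_j by p^i M delta_j, with M the
   norm to K_b: index j is emptied and index i receives M delta_j. *)
apply: (@norm_pair_scale _ _ _ e u (Z u *: alpha + P ^+ i *: (q *: delta j))
          (((Z u \*: delta) \+ at_index i v) \+ at_index j (- (Z u *: delta j)))) => //.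
- case: sha => sz an a0; split.
  + by rewrite size_set_nth sz; apply/maxn_idPr.
  + apply/(all_nthP None) => l; rewrite size_set_nth sz nth_set_nth /=.
    case: eqP => // _; have /maxn_idPr -> := jm; rewrite -sz => ls.
    exact: (all_nthP None an).
  + by rewrite nth_set_nth /= -jj.
split.
- move=> l lm; have := fit l lm; rewrite nth_set_nth /= /at_index.
  case: eqVneq => [->|nlj].
    by rewrite (gtn_eqF ij) addr0 addrN.
  rewrite addr0; case: eqVneq => [->|_].
    by rewrite Dai => fi; apply: fixD; [exact: fixZ | exact: geom_fixed].
  by case: (nth _ _ _) => [x|]; rewrite addr0; [exact: fixZ | move=> ->; rewrite scaler0].
- rewrite !weightedD weightedZ !weighted_at ?(ltnW im) ?(ltnW jm) // -Da /v Dq Dj exprD.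
  by rewrite -Dj; lmod.
rewrite !weighted_normD weighted_normZ wj (weighted_norm_geom (b := b)) ?(ltnW im) //.
rewrite -Dj scalerDr [N n *: (P ^+ i *: _)]scalerA mulrC -scalerA [N n *: (q *: _)]norm_eval; last exact: Xn.
transitivity (Z u *: (Z e *: (N n *: alpha) + weighted_norm m delta)); last by rewrite Dn; lmod.
have E : e * p%:Z ^+ i * q.[1] + p%:Z ^+ j.-1 - p%:Z ^+ j.-1 * u = 0.
  have p0 : p%:Z != 0 by rewrite -lt0n prime_gt0.
  apply: (mulfI p0); rewrite mulr0.
  transitivity (p%:Z ^+ i * (p%:Z * e * q.[1]) + p%:Z ^+ j.-1.+1 * (1 - u)).
    by rewrite exprS; ring.
  by rewrite -qE jj Dj exprD; ring.
apply: lincomb0 (_ : _ = Z (e * p%:Z ^+ i * q.[1] + p%:Z ^+ j.-1 - p%:Z ^+ j.-1 * u)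
  *: (N n *: delta j)) _; first lmod.
by rewrite E scale0r.
Qed.

(** * Descent for elements whose norm is a p-th power *)

Lemma shift_pow (x : {poly int}) (eps : V) (k : int) l :
  x *: xi = xi -> x *: eps = eps + Z k *: xi -> x ^+ l *: eps = eps + Z (l%:Z * k) *: xi.
Proof.
move=> xxi Deps; elim: l => [|l IH]; first by rewrite expr0 scale1r mul0r scale0r addr0.
rewrite exprS -scalerA IH scalerDr Deps (fixZ _ xxi).
by rewrite -addrA -scalerDl -intrD intS; congr (_ + Z _ *: _); ring.
Qed.

(** N_n eps is N_(n-1) of the sum of eps + l k xi over l < p, that is, of p eps + C(p,2) k xi. The
    second term vanishes because p divides C(p,2), or because N_(n-1) xi = p^(n-1) xi = 0 when n >
    1. *)
Lemma norm_root (eps : V) (k : int) : 'X ^+ (p ^ n.-1) *: eps = eps + Z k *: xi ->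
  (p = 2 -> 1 < n)%N -> N n.-1 *: (P *: eps) = N n *: eps.
Proof.
move=> Deps pn; rewrite (@normM n.-1 n) ?leq_pred // -scalerA.
have -> : (n - n.-1 = 1)%N by lia.
rewrite expn1; set x : {poly int} := 'X ^+ _ in Deps *.
have xxi : x *: xi = xi by apply: fixX.
have Xl l := shift_pow l xxi Deps.
have gE l : geom l x *: eps = l%:R *: eps + Z ('C(l, 2)%:Z * k) *: xi.
  elim: l => [|l IH]; first by rewrite geom0 mul0r !scale0r addr0.
  rewrite geomS scalerDl IH Xl binS bin1 PoszD addrC -natr1; lmod.
rewrite gE scalerDr.
have [n1|n1] := leqP n 1.
  have /dvdnP[c ->] : (p %| 'C(p, 2))%N.
    by apply: prime_dvd_bin => //; have := prime_gt1 p_pr; have := pn; lia.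
  have -> : Z ((c * p)%N%:Z * k) *: xi = 0.
    transitivity (Z (c%:Z * k) *: (P *: xi)); last by rewrite Pxi scaler0.
    by rewrite PoszM; lmod.
  by rewrite scaler0 addr0.
have Nxi : N n.-1 *: xi = 0.
  rewrite (fix_geom _ Xxi) natrX; have -> : n.-1 = n.-2.+1 by lia.
  by rewrite exprSr -scalerA Pxi scaler0.
by rewrite [_ *: (Z _ *: xi)]scalerA mulrC -scalerA Nxi scaler0 addr0.
Qed.

(* First correct kappa by the Kummer generator of
   K_{b+1}/K_b to make it fixed, then apply Hilbert 90 over K_{b-1}. *)
Lemma norm_descent b (theta kappa : V) : (b <= n)%N -> fixed b theta ->
  P *: kappa = N b *: theta -> (b = n -> 'X *: kappa = kappa) ->
  exists theta' w lambda : V,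
    [/\ if b is b'.+1 then fixed b' theta' else theta' = 0,
        theta = theta' + ('X - 1) *: w + P *: lambda
      & (b < n)%N -> (p = 2 -> 1 < n)%N -> N n.-1 *: (theta' - theta) = - (N n *: lambda)].
Proof.
move=> bn fth Dk bk.
have [l Dl] : exists l : int, ('X - 1) *: kappa = Z l *: xi.
  apply: torsion; transitivity (('X - 1) *: (P *: kappa)); first lmod.
  rewrite Dk scalerA -geomE scalerBl fth scale1r subrr //.
have X1 : 'X *: kappa = kappa + Z l *: xi by rewrite -Dl scalerBl scale1r addrC subrK.
have Xk j := shift_pow j Xxi X1.
case: b => [|b] in bn fth Dk bk *.
  exists 0, 0, kappa; split=> // [|_ pn].
    by rewrite scaler0 addr0 add0r Dk expn0 geom1 scale1r.
  rewrite sub0r scalerN -(norm_root (Xk _)) //; congr (- _).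
  by rewrite Dk expn0 geom1 scale1r.
(* eps is the Kummer generator: (X - 1) N_(b+1) eps = (X^(p^(b+1)) - 1) eps = l xi = (X - 1) kappa.
   For b + 1 = n, kappa is already fixed and eps = 0. *)
have [eps [epsX pn_eps]] : exists eps : V, 'X *: (kappa - N b.+1 *: eps) = kappa - N b.+1 *: eps
     /\ exists2 k : int, 'X ^+ (p ^ b.+1) *: eps = eps + Z k *: xi & (b.+1 = n -> eps = 0).
  have [bn'|bn'] := eqVneq b.+1 n.
    exists 0; rewrite scaler0 subr0 bk //; split=> //.
    by exists 0; rewrite ?scaler0 ?scale0r ?addr0.
  have [|eps Deps] := @hilbert90 b.+1 (Z l *: xi) bn.
    rewrite fix_geom; last by apply: fixX; apply: fixZ.
    have -> : (n - b.+1 = (n - b.+2).+1)%N by lia.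
    rewrite natrX exprSr.
    by transitivity ((P ^+ (n - b.+2) * Z l) *: (P *: xi)); [lmod | rewrite Pxi scaler0].
  exists eps; split.
    apply: lincomb0 (_ : _ = ('X - 1) *: kappa - (('X - 1) * N b.+1) *: eps) _; first lmod.
    by rewrite Dl -geomE -Deps subrr.
  exists l; last by move=> E; rewrite E eqxx in bn'.
  by rewrite Deps scalerBl scale1r addrC subrK.
case: pn_eps => k Xeps eps0.
set g := kappa - _ in epsX.
pose th1 := theta - P *: eps.
have fth1 : fixed b.+1 th1.
  rewrite /fixed /th1 scalerBr fth; congr (_ - _).
  rewrite scalerA mulrC -scalerA Xeps scalerDr -[RHS]addr0; congr (_ + _).
  by transitivity (Z k *: (P *: xi)); [lmod | rewrite Pxi scaler0].
have Nth1 : N b.+1 *: th1 = P *: g.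
  by rewrite /th1 /g scalerBr -Dk; lmod.
have NbS : N b.+1 = N b * geom p ('X ^+ (p ^ b)) by rewrite (@normM b b.+1) // subSnn expn1.
have gfix : 'X ^+ (p ^ b) *: g = g by apply: fixX.
(* The relative norm of v from K_(b+1) to K_b is N_(b+1) th1 - p g = 0, so Hilbert 90 applies. *)
pose v := N b *: th1 - g.
have Mv : geom p ('X ^+ (p ^ b)) *: v = 0.
  rewrite /v scalerBr (fix_geom _ gfix) scalerA mulrC -NbS Nth1 subrr //.
have [|w Dw] := @hilbert90 b v (ltnW bn).
  have -> : (n - b = 1 + (n - b.+1))%N by lia.
  by rewrite expnD expn1 geomM mulrC -scalerA Mv scaler0.
have fw : fixed b.+1 w.
  apply: lincomb0 (_ : _ = (('X ^+ (p ^ b)) ^+ p - 1) *: w) _.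
    by rewrite /fixed -exprM -expnSr; lmod.
  by rewrite geomE mulrC -scalerA -Dw.
(* The new element lies in K_b: X^(p^b) - 1 maps it to (X - 1) (N_b th1 - v) = (X - 1) g = 0. *)
exists (th1 - ('X - 1) *: w), w, eps; split=> [||bn' pn].
- rewrite /fixed; apply: lincomb0 (_ : _ = ('X - 1) *: (N b *: th1 - g - (('X - 1) * N b) *: w)
     + ('X *: g - g)) _.
    apply: lincomb0 (_ : _ = (('X ^+ (p ^ b) - 1) - ('X - 1) * N b) *: (th1 - ('X - 1) *: w)) _.
      by lmod.
    by rewrite -geomE subrr scale0r.
  by rewrite -geomE -Dw -/v !subrr scaler0 add0r epsX subrr.
- by rewrite /th1; lmod.
have -> : th1 - ('X - 1) *: w - theta = - (('X - 1) *: w) - P *: eps by rewrite /th1; lmod.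
have Xeps' : 'X ^+ (p ^ n.-1) *: eps = eps + Z ((p ^ (n.-1 - b.+1))%N%:Z * k) *: xi.
  have -> : n.-1 = (b.+1 + (n.-1 - b.+1))%N by rewrite subnKC //; lia.
  rewrite addKn expnD exprM; apply: shift_pow Xeps; exact: fixX.
rewrite scalerBr (norm_root Xeps') // scalerN.
suff -> : N n.-1 *: (('X - 1) *: w) = 0 by rewrite oppr0 add0r.
rewrite scalerA mulrC -geomE scalerBl scale1r [_ *: w](_ : _ = w) ?subrr //.
by apply: fixed_leq fw; rewrite -ltnS prednK.
Qed.

(** For the eigenvector z, e N_n z = ((d^(p^n) - 1) / p) z = p^r x z = x xi, so alpha = z with
    trivial delta_j works up to the factor x prime to p. *)
Lemma norm_pair_nil m d r x (z : V) : (0 < m)%N -> (p%:Z %| d - 1)%Z ->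
  P ^+ r *: z = xi -> ('X - Z d) *: z = 0 ->
  d ^+ (p ^ n) - 1 = p%:Z ^+ r.+1 * x -> ~~ (p%:Z %| x)%Z ->
  is_norm_pair m (nseq m None) d.
Proof.
move=> m0 /dvdzP[e De] Dz zd Dx px.
have Dd : d = 1 + p%:Z * e by rewrite -(subrK 1 d) De; ring.
have Xz l : 'X ^+ l *: z = Z d ^+ l *: z.
  elim: l => [//|l IH]; rewrite exprS -scalerA IH scalerA mulrC -scalerA.
  have -> : 'X *: z = Z d *: z by apply/eqP; rewrite -subr_eq0 -scalerBl zd.
  by rewrite scalerA -exprSr.
have Nz : N n *: z = geom (p ^ n) (Z d) *: z.
  by rewrite /geom !scaler_suml; apply: eq_bigr => l _; exact: Xz.
have E : e * geom (p ^ n) d = p%:Z ^+ r * x.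
  have p0 : p%:Z != 0 by rewrite -lt0n prime_gt0.
  apply: (mulfI p0); rewrite [RHS]mulrA -exprS -Dx geomE De; ring.
apply: (norm_pair_scale (u := x) (alpha := z) (delta := fun=> 0) Dd) => //.
  split; [by rewrite size_nseq | by rewrite all_nseq orbT | by rewrite nth_nseq m0].
split.
- by move=> i im; rewrite nth_nseq im.
- by rewrite zd /weighted big1 // => i _; rewrite scaler0.
rewrite Nz /weighted_norm big1 => [|i _]; last by rewrite !scaler0.
rewrite scaler0 !addr0 -(geom_morph intr) /= -Dz.
transitivity (Z (e * geom (p ^ n) d) *: z); first lmod.
by rewrite E; lmod.
Qed.

(** * Lowering an entry of a norm pair *)

Definition lower_entry (x : option nat) := if x is Some b.+1 then Some b else None.

Lemma lexlt_nth (s t : seq (option nat)) i : size s = size t -> (i < size s)%N ->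
  (forall j, (j < i)%N -> nth None s j = nth None t j) ->
  olt_minf (nth None s i) (nth None t i) -> lexlt s t.
Proof.
elim: s t i => [|x s IH] [|y t] [|i] //= [sz] si Hj Hi; first by rewrite Hi.
have -> : x = y by apply: (Hj 0).
by rewrite eqxx (IH t i) ?orbT // => j ji; apply: (Hj j.+1).
Qed.

(** Index i is left out of the construction of the root: z = q' alpha + B satisfies p^r z + p^(r-1)
    u T_b delta_i = xi = p^r y. So p z + u T_b delta_i - p y is p^(r-1)-torsion, hence a multiple of
    p^2 y, and the norm of u delta_i from K_b to F has the form p kappa. Then [norm_descent] moves
    it to the next smaller field. *)
Lemma norm_pair_lower m a d i b r u (y : V) : is_norm_pair m a d ->
  (i < m)%N -> nth None a i = Some b -> (r + b = n + i)%N -> (0 < r < m)%N ->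
  (forall j k, (j < m)%N -> j != i -> nth None a j = Some k -> (r.+1 + k <= n + j)%N) ->
  (p%:Z ^+ r.+1 %| d ^+ (p ^ n) - 1)%Z -> P ^+ r *: y = xi ->
  (b = n -> ('X - Z d) *: y = 0) ->
  geom (p ^ (n - b)) (d ^+ (p ^ b)) = p%:Z ^+ (n - b) * u -> ~~ (p%:Z %| u)%Z ->
  (i = 0 -> p = 2 -> 1 < n)%N ->
  exists2 a', is_norm_pair m a' d & lexlt a' a.
Proof.
move=> [e [alpha [delta [Dd sha [fit Da Dn]]]]] im Dai rb /andP[r0 rm] Hj /dvdzP[q' Dq'] Dy yb Du pu pn.
have m0 : (0 < m)%N by apply: leq_ltn_trans im.
have bn : (b <= n)%N := valid_entries_le sha Dai.
have fi : fixed b (delta i) by have := fit i im; rewrite Dai.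
have Dq : p%:Z ^+ r.+1 * q' = d ^+ (p ^ n) - 1 by rewrite Dq' mulrC.
have [|B [B1 B2]] := beta_sum Dd (I := fun j => j != i) sha fit m0 rm _ Dq.
  by move=> j k jm ji; apply: Hj.
pose i' : 'I_m.+1 := Ordinal (ltnW im : i < m.+1)%N.
have Iall F : \sum_(j < m.+1) F j = F i' + \sum_(j < m.+1 | nat_of_ord j != i) F j :> V.
  by rewrite (bigD1 i').
have := norm_equation Dd Dq Da; rewrite Dn scale1r Iall -B2 /=.
have -> : term_norm d e i (delta i) = P ^+ r.-1 *: (Z u *: (T d b *: delta i)).
  have Dc : p%:Z ^+ r.-1.+1 * u = p%:Z ^+ i * index_sum d b.
    by rewrite /index_sum Du prednK // mulrA -exprD; congr (_ ^+ _ * _); lia.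
  have b0 : (i = 0 -> b < n)%N by move=> i0; case: sha => _ _; rewrite -i0 Dai.
  move: (delta i) fi => v fv; case: (i) Dc b0 => [|i0] Dc b0.
    by apply/esym/(beta_norm0 Dd _ fv); rewrite ?b0 // Dc expr0 mul1r.
  exact/esym/(beta_normS bn fv Dc).
move=> Exi.
pose z := Z q' *: alpha + B.
have {Exi}Exi : P ^+ r *: z + P ^+ r.-1 *: (Z u *: (T d b *: delta i)) = xi.
  by rewrite -[RHS]Exi /z; lmod.
have [k Dk] : exists k : int, P *: z + Z u *: (T d b *: delta i) - P *: y = Z k *: (P *: (P *: y)).
  have E0 : P ^+ r.-1 *: (P *: z + Z u *: (T d b *: delta i) - P *: y) = 0.
    apply: lincomb0 (_ : _ = (P ^+ r *: z + P ^+ r.-1 *: (Z u *: (T d b *: delta i)) - xi)) _.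
      by rewrite -Dy -[in RHS](prednK r0) -[in LHS](prednK r0) /= exprS; lmod.
    by rewrite Exi subrr.
  have [r1|r1] := posnP r.-1.
    by exists 0; rewrite scale0r -[LHS]scale1r; move: E0; rewrite r1 expr0.
  apply: (@root_generates r.-2); last by rewrite (prednK r1).
  by rewrite !scalerA mulrA -!exprSr (prednK r1) (prednK r0).
set theta := Z u *: delta i.
pose U : {poly int} := homsum_err (p ^ b) 'X (Z d) (Z e).
have DT : T d b = N b + P * U by apply: homsum_errE; exact: ZD.
pose kappa := (1 + Z k * P) *: y - z - U *: theta.
have Pkappa : P *: kappa = N b *: theta.
  apply: lincomb0 (_ : _ = - (P *: z + Z u *: (T d b *: delta i) - P *: y - Z k *: (P *: (P *: y)))) _.
    by rewrite /kappa /theta DT; lmod.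
  by rewrite Dk subrr oppr0.
have fth : fixed b theta by apply: fixZ.
(* K has no Kummer extension inside itself, so when b = n the root kappa must
   already be fixed: this is where (X - d) y = 0 is used. *)
have kfix : b = n -> 'X *: kappa = kappa.
  move=> bE; have u1 : u = 1.
    by move: Du; rewrite bE subnn expn0 geom1 expr0 mul1r.
  have Dz : ('X - Z d) *: z = (Z q' * P ^+ i) *: delta i.
    rewrite /z scalerDr B1.
    transitivity (Z q' *: (('X - Z d) *: alpha - \sum_(j < m.+1 | nat_of_ord j != i) P ^+ j *: delta j)).
      by lmod.
    by rewrite Da /weighted Iall addrK; lmod.
  have thE : theta = delta i by rewrite /theta u1 scale1r.
  have UE : U = twist_err d e by rewrite /U bE.
  have ri : i = r by lia.
  have WE := twist_errE Dd Dq.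
  apply: lincomb0 (_ : _ = ('X - Z d) *: kappa + Z e *: (P *: kappa)) _.
    by rewrite (ZD Dd); lmod.
  rewrite Pkappa bE /kappa.
  transitivity ((1 + Z k * P) *: (('X - Z d) *: y) - ('X - Z d) *: z
     + ((Z d - 'X) * U + Z e * N n) *: theta); first by lmod.
  by rewrite yb // Dz UE WE thE ri; lmod.
have [theta' [w [lambda [fth' Dth Hth]]]] := norm_descent bn fth Pkappa kfix.
(* As X - 1 = (X - d) + p e, the term (X - 1) w splits into a part moved to alpha and a part p e w
   moved to index i + 1. *)
pose lambda' := lambda + Z e *: w.
have Dth2 : theta' - theta = - (('X - Z d) *: w) - P *: lambda'.
  by rewrite Dth /lambda' (ZD Dd); lmod.
(* Index i + 1 now takes any element of K, which does no harm since the first difference is at i. If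
   i + 1 = m there is no such entry. *)
pose a' := mkseq (fun j => if j == i then lower_entry (Some b)
                           else if j == i.+1 then Some n else nth None a j) m.
have Da' j : (j < m)%N -> nth None a' j = if j == i then lower_entry (Some b)
    else if j == i.+1 then Some n else nth None a j by move=> jm; rewrite nth_mkseq.
exists a'; last first.
  apply: (@lexlt_nth _ _ i); rewrite ?size_mkseq //.
  - by case: sha.
  - move=> j ji; rewrite Da' ?(ltn_trans ji) // (ltn_eqF ji) ltn_eqF //.
    by rewrite (ltn_trans ji).
  by rewrite Da' // eqxx Dai; case: (b) => //= b' ; rewrite ltnS.
apply: (norm_pair_scale (u := u) (alpha := Z u *: alpha - P ^+ i *: w)
  (delta := ((Z u \*: delta) \+ at_index i (theta' - theta)) \+ at_index i.+1 lambda') Dd) => //.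
  case: sha => sz an a0; split; first by rewrite size_mkseq.
    apply/(all_nthP None) => j; rewrite size_mkseq => jm; rewrite Da' //.
    case: eqP => _; first by case: (b) bn => //= b'; apply: ltnW.
    by case: eqP => _ //=; apply: (all_nthP None an); rewrite sz.
  rewrite Da' //; case: eqP => [i0|_] //=.
  by move: a0; rewrite i0 Dai; case: (b) => //= b'; apply: ltnW.
split.
- move=> j jm; have := fit j jm; rewrite Da' //= /at_index.
  case: eqVneq => [->|_] fj.
    rewrite ltn_eqF // addr0 /theta addrC subrK.
    by case: (b) fth' => [|b'].
  rewrite addr0; case: eqVneq => [_|_]; first exact: Xn.
  by case: (nth _ _ _) fj => [l|]; rewrite addr0; [exact: fixZ | move=> ->; rewrite scaler0].
- rewrite !weightedD weightedZ !weighted_at ?(ltnW im) // -Da Dth2 exprS; lmod.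
rewrite !weighted_normD weighted_normZ weighted_norm_atS //.
transitivity (Z u *: (Z e *: (N n *: alpha) + weighted_norm m delta)); last by rewrite Dn; lmod.
have -> : weighted_norm m (at_index i (theta' - theta)) = P ^+ i *: (Z e *: (N n *: w) - N n *: lambda').
  case: (i) (im) (Dai) (pn) => [|j] jm Daj pn'.
    rewrite weighted_norm_at0 Hth //; first by rewrite /lambda'; lmod.
      by case: sha => _ _; rewrite Daj.
    exact: pn'.
  rewrite weighted_norm_atS; last exact: ltnW.
  have Nw : (N n * ('X - 1)) *: w = 0.
    by rewrite mulrC -geomE scalerBl scale1r Xn subrr.
  apply: lincomb0 (_ : _ = - (P ^+ j) *: ((N n * ('X - 1)) *: w)) _; last by rewrite Nw scaler0.
  by rewrite Dth2 (ZD Dd) exprS; lmod.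
by lmod.
Qed.

Lemma lexlt_asym s t : lexlt s t -> ~~ lexlt t s.
Proof.
elim: s t => [|x s IH] [|y t] //=.
case: x y => [x|] [y|] //=.
- case: (ltngtP x y) => [xy|yx|->] /=.
  + by move=> _; apply/negP => /andP[/eqP[E]]; rewrite E ltnn in xy.
  + by move=> /andP[/eqP[E]]; rewrite E ltnn in yx.
  by rewrite !eqxx; exact: IH.
exact: IH.
Qed.

Lemma lexlt_irr s : ~~ lexlt s s.
Proof. by apply/negP => h; have := lexlt_asym h; rewrite h. Qed.

Lemma lexlt_nil s k : ~~ lexlt s (nseq k None).
Proof.
by elim: s k => [|x s IH] [|k] //=; rewrite negb_or negb_and IH orbT; case: x.
Qed.

Lemma leq_vmin m j (x : int) : (j <= m)%N -> (j <= vmin p m x)%N = (p%:Z ^+ j %| x)%Z.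
Proof.
move=> jm; rewrite /vmin; case: eqVneq => [->|x0]; first by rewrite dvdz0.
by rewrite leq_min jm andbT dvdzE abszX -pfactor_dvdn // absz_gt0.
Qed.

Lemma vmin_mono m (x y : int) :
  (forall j, (j <= m)%N -> (p%:Z ^+ j %| x)%Z -> (p%:Z ^+ j %| y)%Z) ->
  (vmin p m x <= vmin p m y)%N.
Proof.
have vm : (vmin p m x <= m)%N by rewrite /vmin; case: ifP => // _; apply: geq_minr.
by move=> h; rewrite (leq_vmin _ vm) h // -(leq_vmin _ vm).
Qed.

(** * Minimal norm pairs and the roots of unity they produce *)

Definition is_minimal m a d := is_norm_pair m a d /\
  forall a' d', is_norm_pair m a' d' -> np_le p m a d a' d'.

Lemma minimal_lex m a d a' d' : is_minimal m a d -> is_norm_pair m a' d' -> ~~ lexlt a' a.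
Proof.
move=> [_ amin] /amin /orP[/lexlt_asym //|/andP[/eqP-> _]]; exact: lexlt_irr.
Qed.

Lemma norm_pair_dvd m a d : is_norm_pair m a d -> (p%:Z %| d - 1)%Z.
Proof. by case=> e [_ [_ [-> _ _]]]; rewrite addrAC subrr add0r dvdz_mulr. Qed.

Lemma root_fixed r (f w : V) : P ^+ r *: f = xi -> 'X *: f = f -> P ^+ r.+1 *: w = 0 ->
  'X *: w = w.
Proof. by move=> Df Xf /(root_generates Df)[k ->]; apply: fixZ. Qed.

Hypothesis norm_minus1 : p = 2%N -> n = 1%N -> exists x : V, N n *: x = xi.
Hypothesis mu4_fixed : p = 2%N -> forall z : V, P *: z = xi -> 'X *: z = z.

(** By hypothesis xi = N x. As N (p x) = 0, Hilbert 90 gives p x = (X - 1) alpha, so alpha with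
    delta_1 = x represents the pair with d = 1, first entry -oo and all others n. It lies below
    every pair with finite first entry. *)
Lemma minimal_head m a d : is_minimal m a d -> (0 < m)%N -> p = 2%N -> n = 1%N ->
  nth None a 0 = None.
Proof.
move=> amin m0 p2 n1; have [x Nx] := norm_minus1 p2 n1.
have [|alpha Dalpha] := @hilbert90 0 (P *: x) isT.
  by rewrite subn0 expn0 expr1 scalerA mulrC -scalerA Nx.
pose a' := mkseq (fun j => if j is 0 then None else Some n) m.
case a0: (nth None a 0) => [b|] //; exfalso.
suff /(minimal_lex amin)/negP : is_norm_pair m a' 1.
  have sz : size a = m by case: amin => -[e [_ [_ [_ [sz _ _] _]]]] _.
  case; apply: (@lexlt_nth _ _ 0); rewrite ?size_mkseq //.
  by rewrite nth_mkseq // a0.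
have D1 : 1 = 1 + p%:Z * 0 by rewrite mulr0 addr0.
apply: (norm_pair_scale (u := 1) (alpha := alpha) (delta := at_index 1 x) D1) => //.
- split; first by rewrite size_mkseq.
    by apply/(all_nthP None) => j; rewrite size_mkseq => jm; rewrite nth_mkseq //; case: j jm => /=.
  by rewrite nth_mkseq.
- by apply/negP; rewrite dvdz1 /= gtn_eqF ?prime_gt1.
split.
- move=> j jm; rewrite nth_mkseq // /at_index; case: j jm => [//|j] jm /=; exact: Xn.
- by rewrite weighted_at // expr1 Dalpha expn0 expr1.
by rewrite scale0r add0r weighted_norm_atS // expr0 !scale1r.
Qed.

(** Supplies the condition modulo 4 in [geom_expn_unit]. For b > 0 squaring suffices. For b = 0 and
    r > 0 a multiple of z is a primitive 4th root of unity, fixed by [mu4_fixed], so its eigenvalue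
    d is 1 mod 4. For b = r = 0 one has n = 1 and i = 0, which [minimal_head] excludes. *)
Lemma minimal_four m a d r i b (z : V) : is_minimal m a d -> (0 < m)%N ->
  P ^+ r *: z = xi -> ('X - Z d) *: z = 0 -> nth None a i = Some b -> (r.+1 + b = n + i)%N ->
  p = 2%N -> (4 %| d ^+ (p ^ b) - 1)%Z.
Proof.
move=> amin m0 Dz zd Dai rb p2; have [np _] := amin; have pd := norm_pair_dvd np.
have -> : 4 = p%:Z ^+ 2 by rewrite p2.
case: b => [|b] in Dai rb *.
  case: r => [|r] in Dz rb *.
    have [n1 i0] : n = 1%N /\ i = 0%N by lia.
    by have := minimal_head amin m0 p2 n1; rewrite -i0 Dai.
  have f2 : P *: (P ^+ r *: z) = xi by rewrite scalerA -exprS.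
  rewrite expn0 expr1; apply: (root_order (y := P ^+ r *: z)); rewrite ?expr1 //.
  have Xf := mu4_fixed p2 f2.
  apply: lincomb0 (_ : _ = ('X *: (P ^+ r *: z) - P ^+ r *: z) - P ^+ r *: (('X - Z d) *: z)) _.
    by lmod.
  by rewrite Xf zd scaler0 !subrr.
have := @dvdz_expn_sub p p_pr d 1 1 b.+1 isT; rewrite expr1 => /(_ pd).
by rewrite expr1n; apply: dvdz_trans; apply: dvdz_exp2l.
Qed.

Lemma minimal_unit m a d r i b (z : V) k : is_minimal m a d -> (0 < m)%N ->
  P ^+ r *: z = xi -> ('X - Z d) *: z = 0 -> nth None a i = Some b -> (r.+1 + b = n + i)%N ->
  exists2 u, geom (p ^ k) (d ^+ (p ^ b)) = p%:Z ^+ k * u & ~~ (p%:Z %| u)%Z.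
Proof.
move=> amin m0 Dz zd Dai rb.
have pd : (p%:Z %| d ^+ (p ^ b) - 1)%Z.
  by rewrite geomE dvdz_mulr // (norm_pair_dvd amin.1).
have [|u Du pu] := geom_expn_unit p_pr k pd; first exact: minimal_four amin m0 Dz zd Dai rb.
exists u => //; apply/negP => pu'.
have : (p%:Z %| 1%R)%Z by rewrite -(subKr u 1) rpredB.
by rewrite dvdz1 /= gtn_eqF ?prime_gt1.
Qed.

Lemma eigen_pow (y : V) c l : 'X *: y = Z c *: y -> 'X ^+ l *: y = Z (c ^+ l) *: y.
Proof.
move=> Xy; elim: l => [|l IH]; first by rewrite !expr0.
rewrite exprS -scalerA IH scalerA mulrC -scalerA Xy exprSr; lmod.
Qed.

Lemma eigen_dvd r (y : V) c d : P ^+ r *: y = xi -> 'X *: y = Z c *: y ->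
  ('X - Z d) *: y = 0 -> (p%:Z ^+ r.+1 %| c - d)%Z.
Proof.
move=> Dy Xy yd; apply: (root_order Dy _).
by apply: lincomb0 (_ : _ = Z c *: y - 'X *: y + ('X - Z d) *: y) _; [lmod | rewrite Xy yd subrr addr0].
Qed.

(** Induction on r. Level r gives an eigenvector z for d; comparing it with p y shows that d is
    close enough to the eigenvalue c of y for the divisibility. An inequality failing at level r + 1
    was an equality at level r; let i be the least such index. A later equality could be dropped
    from the pair, so i is the only one, and [norm_pair_lower] contradicts minimality. *)
Lemma minimal_entries m a d r (y : V) : is_minimal m a d -> (r < m)%N -> P ^+ r *: y = xi ->
  (p%:Z ^+ r.+1 %| d ^+ (p ^ n) - 1)%Z /\
  forall j k, (j < m)%N -> nth None a j = Some k -> (r.+1 + k <= n + j)%N.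
Proof.
move=> amin; have [np _] := amin; elim: r y => [|r IH] y rm Dy.
  case: np => e [alpha [delta [Dd sha _]]]; split.
    by rewrite expr1 geomE dvdz_mulr // (norm_pair_dvd amin.1).
  move=> [|j] k jm Daj; last by have := valid_entries_le sha Daj; lia.
  by case: sha => _ _; rewrite Daj addn0.
have m0 : (0 < m)%N by apply: leq_ltn_trans rm.
have DPy : P ^+ r *: (P *: y) = xi by rewrite scalerA -exprSr.
have [/dvdzP[q Dq] Hr] := IH _ (ltnW rm) DPy.
have [z Dz zd] : exists2 z, P ^+ r *: z = xi & ('X - Z d) *: z = 0.
  case: (np) => e [alpha [delta [Dd sha rep]]].
  by apply: (norm_rep_root Dd sha m0 (ltnW rm) rep Hr (q := q)); rewrite Dq mulrC.
have [k0 Dk0] : exists k : int, P *: y = Z k *: z.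
  apply: (root_generates Dz _); by rewrite exprS -scalerA DPy Pxi.
have [c Xy] : exists c : int, 'X *: y = Z c *: y.
  apply: (root_generates Dy _).
  by rewrite scalerA mulrC -scalerA exprS -scalerA Dy Pxi scaler0.
have cd : (p%:Z ^+ r.+1 %| c - d)%Z.
  apply: (eigen_dvd DPy _ _).
    by rewrite scalerA mulrC -scalerA Xy; lmod.
  by rewrite Dk0 scalerA mulrC -scalerA zd scaler0.
have c1 : (p%:Z ^+ r.+2 %| c ^+ (p ^ n) - 1)%Z.
  apply: (root_order Dy _).
  apply: lincomb0 (_ : _ = Z (c ^+ (p ^ n)) *: y - y) _; first lmod.
  by rewrite -eigen_pow // Xn subrr.
have d1 : (p%:Z ^+ r.+2 %| d ^+ (p ^ n) - 1)%Z.
  have -> : d ^+ (p ^ n) - 1 = (c ^+ (p ^ n) - 1) - (c ^+ (p ^ n) - d ^+ (p ^ n)) by ring.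
  rewrite rpredB //; apply: dvdz_trans (@dvdz_expn_sub p p_pr c d r.+1 n isT cd).
  by apply: dvdz_exp2l; lia.
split=> // j k jm Daj; rewrite leqNgt; apply/negP => jk.
pose Q j := (j < m)%N && (if nth None a j is Some k then r.+1 + k == n + j else false)%N.
have exQ : exists j, Q j.
  by exists j; rewrite /Q jm Daj eqn_leq (Hr _ _ jm Daj) -ltnS.
case: (ex_minnP exQ) => i /andP[im]; case Dai: (nth None a i) => [b|] // /eqP rb imin.
have drop l l' : (i < l < m)%N -> nth None a l = Some l' -> (r.+1 + l')%N = (n + l)%N -> False.
  move=> /andP[il lm] Dal rl.
  have [u Du pu] := minimal_unit (l - i)%N amin m0 Dz zd Dai rb.
  have Dl' : l' = (b + (l - i))%N by clear -rb rl il; lia.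
  rewrite Dl' in Dal.
  have := @norm_pair_drop m a d i l b u np; rewrite il lm => /(_ isT Dai Dal Du pu).
  move=> /(minimal_lex amin)/negP; apply.
  have sz : size a = m by case: np => e [_ [_ [_ [sz _ _] _]]].
  apply: (@lexlt_nth _ _ l).
  - by rewrite size_set_nth sz; apply/maxn_idPr.
  - by rewrite size_set_nth sz leq_max ltnSn.
  - by move=> h hl; rewrite nth_set_nth /= ltn_eqF.
  - by rewrite nth_set_nth /= eqxx Dal.
have Hj l l' : (l < m)%N -> l != i -> nth None a l = Some l' -> (r.+2 + l' <= n + l)%N.
  move=> lm li Dal; rewrite addSn ltn_neqAle Hr // andbT; apply/eqP => E.
  have [il|] := ltnP i l; first by apply: (drop l l') => //; rewrite il.
  rewrite leq_eqVlt (negPf li) /= => li'.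
  by have := imin l; rewrite /Q lm Dal E eqxx => /(_ isT); rewrite leqNgt li'.
have [u Du pu] := minimal_unit (n - b)%N amin m0 Dz zd Dai rb.
have pn : (i = 0 -> p = 2 -> 1 < n)%N.
  move=> i0 p2; rewrite ltn_neqAle n_gt0 andbT; apply/eqP => n1.
  by have := minimal_head amin m0 p2 (esym n1); rewrite -i0 Dai.
(* If a_i = n, the pair (a, c) is as good as (a, d), and y is an eigenvector for c. *)
have [bn|bn] := eqVneq b n.
  have ri : i = r.+1 by move: rb; rewrite bn addnC => /addnI.
  have npc : is_norm_pair m a c.
    have rm1 : (0 < r.+1 <= m)%N by rewrite ltn0Sn ltnW.
    have ja : r.+1 = m \/ nth None a r.+1 = Some n by right; rewrite -ri Dai bn.
    exact: norm_pair_change rm1 ja cd np.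
  have [a' npa' lta] : exists2 a', is_norm_pair m a' c & lexlt a' a.
    apply: (@norm_pair_lower m a c i b r.+1 1 y npc) => //.
    - by move=> _; rewrite scalerBl Xy subrr.
    - by rewrite bn subnn geom1.
    - by rewrite dvdz1 /= gtn_eqF ?prime_gt1.
  by have := minimal_lex amin npa'; rewrite lta.
have [a' npa' lta] : exists2 a', is_norm_pair m a' d & lexlt a' a.
  apply: (@norm_pair_lower m a d i b r.+1 u y np) => //.
  by move=> E; rewrite E eqxx in bn.
by have := minimal_lex amin npa'; rewrite lta.
Qed.

Lemma minimal_root m a d r (y : V) : is_minimal m a d -> (r < m)%N -> P ^+ r *: y = xi ->
  exists2 z, P ^+ r *: z = xi & ('X - Z d) *: z = 0.
Proof.
move=> amin rm Dy; have [/dvdzP[q Dq] Hr] := minimal_entries amin rm Dy.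
have [[e [alpha [delta [Dd sha rep]]]] _] := amin.
apply: (norm_rep_root Dd sha (leq_ltn_trans (leq0n r) rm) rm rep Hr (q := q)).
by rewrite Dq mulrC.
Qed.

(** If no inequality of level r is an equality, then p does not divide x, or K would contain a
    larger root of unity; [norm_pair_nil] then applies to dt, and minimality forces all entries of a
    to be -oo. Otherwise an equality at i permits [norm_pair_shift]. *)
Lemma minimal_shift m a d r (y : V) dt : is_minimal m a d -> (r.+1 < m)%N ->
  P ^+ r *: y = xi -> (forall z : V, P ^+ r.+1 *: z != xi) ->
  (p%:Z ^+ r.+1 %| dt - d)%Z -> is_norm_pair m a dt.
Proof.
move=> amin rm Dy noroot pdt; have [np amin'] := amin.
have m0 : (0 < m)%N by apply: leq_ltn_trans rm.
have rm' := ltnW rm.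
have [/dvdzP[x Dx] Hr] := minimal_entries amin rm' Dy.
have [z Dz zd] := minimal_root amin rm' Dy.
have [/existsP[[i im] /=]|noi] := boolP [exists i : 'I_m,
    if nth None a i is Some b then r.+1 + b == n + i else false]%N; last first.
  have px : ~~ (p%:Z %| x)%Z.
    apply/negP => /dvdzP[q Dq].
    have [e [alpha [delta [Dd sha rep]]]] := np.
    have [||z' Dz' _] := norm_rep_root Dd sha m0 rm rep (q := q).
    - move=> j k jm Daj; rewrite addSn ltn_neqAle Hr // andbT; apply/eqP => E.
      by case/existsP: noi; exists (Ordinal jm); rewrite /= Daj E.
    - by rewrite Dx Dq exprSr; ring.
    by have := noroot z'; rewrite Dz' eqxx.
  have pdt1 : (p%:Z %| dt - 1)%Z.
    have -> : dt - 1 = (dt - d) + (d - 1) by ring.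
    rewrite rpredD ?(norm_pair_dvd np) //; apply: dvdz_trans pdt.
    by rewrite exprS dvdz_mulr.
  have ztd : ('X - Z dt) *: z = 0.
    have /dvdzP[t Dt] := pdt; have -> : dt = d + t * p%:Z ^+ r.+1 by rewrite -Dt; ring.
    apply: lincomb0 (_ : _ = ('X - Z d) *: z - Z t *: (P *: (P ^+ r *: z))) _.
      by rewrite exprS; lmod.
    by rewrite zd Dz Pxi scaler0 subrr.
  have /dvdzP[t Dt] := @dvdz_expn_sub p p_pr dt d r.+1 n isT pdt.
  have Dxt : dt ^+ (p ^ n) - 1 = p%:Z ^+ r.+1 * (x + t * p%:Z ^+ n).
    have -> : dt ^+ (p ^ n) - 1 = (dt ^+ (p ^ n) - d ^+ (p ^ n)) + (d ^+ (p ^ n) - 1) by ring.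
    by rewrite Dt Dx exprD; ring.
  have npnil : is_norm_pair m (nseq m None) dt.
    apply: (norm_pair_nil m0 pdt1 Dz ztd Dxt).
    apply/negP => h; case/negP: px; rewrite -(addrK (t * p%:Z ^+ n) x) rpredB //.
    by rewrite -(prednK n_gt0) exprS dvdz_mull // dvdz_mulr.
  by have /orP[h|/andP[/eqP-> _]] := amin' _ _ npnil; [have := lexlt_nil a m; rewrite h|].
case Dai: (nth None a i) => [b|] // /eqP rb.
have bn : (b <= n)%N by case: (np) => e [_ [_ [_ sha _]]]; apply: valid_entries_le sha Dai.
have [u Du pu] := minimal_unit (n - b) amin m0 Dz zd Dai rb.
have /dvdzP[t Dt] := pdt.
(* w is an inverse of u modulo p^m: the shift by w t reaches dt modulo p^m, and delta_m absorbs the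
   rest. *)
have /coprimezP[[s w] /= sw] : coprimez (p%:Z ^+ m) u.
  by apply: coprimezXl; rewrite coprimezE prime_coprime.
have npu : is_norm_pair m a (d + p%:Z ^+ (i + (n - b)) * u * (w * t)).
  apply: (norm_pair_shift (w * t) np im Dai (subnKC bn) Du) => i0 p2.
  have n1 : (1 < n)%N.
    rewrite ltn_neqAle n_gt0 andbT; apply/eqP => n1.
    by have := minimal_head amin m0 p2 (esym n1); rewrite -i0 Dai.
  by case: (b) => //; rewrite subn0.
apply: (norm_pair_change (j := m)) npu; [by rewrite m0 leqnn | by left |].
have -> : (i + (n - b) = r.+1)%N by clear -rb bn; lia.
have -> : dt - (d + p%:Z ^+ r.+1 * u * (w * t)) = (dt - d) - p%:Z ^+ r.+1 * t * (w * u) by ring.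
have -> : w * u = 1 - s * p%:Z ^+ m by rewrite -sw; ring.
by rewrite Dt; apply/dvdzP; exists (p%:Z ^+ r.+1 * t * s); ring.
Qed.

(** The module form of [is_mu_level]: p^(k-1) y = xi says that y is a primitive p^k-th root of
    unity. The demand 0 < k reflects that xi lies in F. *)
Definition root_level (Q : V -> Prop) (w : option nat) :=
  if w is Some k then [/\ (0 < k)%N, exists2 y, Q y & P ^+ k.-1 *: y = xi
                       & forall y, Q y -> P ^+ k *: y != xi]
  else forall k, exists2 y, Q y & P ^+ k *: y = xi.

(** The third claim holds because z is a primitive p^M-th root of unity with eigenvalue d. If nu <
    m, [minimal_shift] frees d modulo p^nu; for minimality only the valuation of d - 1 remains to be
    compared. *)
Lemma minimal_norm_pairs omega nu m a d :
  root_level (fun y => 'X *: y = y) omega -> root_level (fun=> True) nu ->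
  (0 < m)%N -> is_minimal m a d ->
  [/\ olt_inf omega nu -> forall dt, congr_ext p nu dt d -> is_minimal m a dt,
      omega = nu -> (p%:Z ^+ m %| d - 1)%Z
    & forall c : int,
        (forall z : V, P ^+ min_ext m nu *: z = 0 -> 'X *: z = Z c *: z) ->
        (p%:Z ^+ min_ext m nu %| d - c)%Z].
Proof.
move=> omP nuP m0 amin; have [np amin'] := amin.
set M := min_ext m nu.
have [M0 Mm [y Dy]] : [/\ (0 < M)%N, (M <= m)%N & exists y, P ^+ M.-1 *: y = xi].
  rewrite /M /min_ext; case: (nu) nuP => [v [v0 [y _ Dy] _] | H].
    split; [by rewrite leq_min m0 | exact: geq_minl | exists (P ^+ (v.-1 - (minn m v).-1) *: y)].
    rewrite scalerA -exprD subnKC // -!subn1 leq_sub2r // geq_minr //.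
  by split=> //; have [y _ Dy] := H m.-1; exists y.
have M1m : (M.-1 < m)%N by rewrite prednK.
have [z Dz zd] := minimal_root amin M1m Dy.
have chi c : (forall z : V, P ^+ M *: z = 0 -> 'X *: z = Z c *: z) -> (p%:Z ^+ M %| d - c)%Z.
  move=> Hc; rewrite -(prednK M0); apply: (root_order Dz _).
  have Xz : 'X *: z = Z c *: z.
    by apply: Hc; rewrite -(prednK M0) exprS -scalerA Dz Pxi.
  by apply: lincomb0 (_ : _ = ('X *: z - Z c *: z) - ('X - Z d) *: z) _; [lmod | rewrite Xz zd !subrr].
have shift v dt : nu = Some v -> (v < m)%N -> (p%:Z ^+ v %| dt - d)%Z -> is_norm_pair m a dt.
  move=> nuE vm pdt; rewrite nuE in nuP; case: nuP => v0 [y' _ Dy'] noroot.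
  have vS := prednK v0; apply: (minimal_shift (r := v.-1) amin) Dy' _ _; rewrite ?vS //.
  by move=> z'; apply: noroot.
split=> // [omnu dt|omnu].
  have from_np : is_norm_pair m a dt -> (vmin p m (d - 1) <= vmin p m (dt - 1))%N -> is_minimal m a dt.
    move=> npt vle; split=> // a' d' /amin'; rewrite /np_le => /orP[-> //|/andP[aa vd]].
    by apply/orP; right; rewrite aa (leq_trans vd).
  rewrite /congr_ext; case nuE: nu => [v|]; last by move=> ->.
  rewrite eqz_mod_dvd PoszX => pdt.
  have [vm|mv] := ltnP v m; last first.
    have pm : (p%:Z ^+ m %| dt - d)%Z by apply: dvdz_trans pdt; apply: dvdz_exp2l.
    apply: from_np; first by apply: (norm_pair_change (j := m)) pm np; [rewrite m0 leqnn | left].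
    apply: vmin_mono => j jm pj; have -> : dt - 1 = (dt - d) + (d - 1) by ring.
    by rewrite rpredD //; apply: dvdz_trans pm; apply: dvdz_exp2l.
  apply: from_np; first exact: shift nuE vm pdt.
  (* Otherwise sigma would fix z, a primitive p^nu-th root, against omega < nu. So the valuation of
     d - 1 is below nu and carries over to dt - 1. *)
  have npv : ~~ (p%:Z ^+ v %| d - 1)%Z.
    apply/negP => /dvdzP[t Dt]; have ME : M = v by rewrite /M nuE /=; apply/minn_idPr; exact: ltnW.
    have Xz : 'X *: z = z.
      apply: lincomb0 (_ : _ = ('X - Z d) *: z + Z t *: (P ^+ v *: z)) _.
        by rewrite (_ : d = 1 + t * p%:Z ^+ v); [lmod | rewrite -Dt; ring].
      by rewrite zd add0r -ME -(prednK M0) exprS -scalerA Dz Pxi scaler0.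
    case: (omega) omP omnu => [w|] //=; rewrite nuE /= => -[w0 _ noroot] wv.
    have := noroot (P ^+ (v.-1 - w) *: z) (fixZ _ Xz).
    by rewrite scalerA -exprD subnKC -?ME ?Dz ?eqxx // -ltnS ME prednK // -ME.
  apply: vmin_mono => j jm pj; have -> : dt - 1 = (dt - d) + (d - 1) by ring.
  rewrite rpredD //; apply: dvdz_trans pdt; apply: dvdz_exp2l.
  rewrite leqNgt; apply/negP => vj; case/negP: npv; apply: dvdz_trans pj.
  by apply: dvdz_exp2l; apply: ltnW.
have [f Xf Df] : exists2 f, 'X *: f = f & P ^+ M.-1 *: f = xi.
  rewrite omnu in omP; rewrite /M /min_ext; case: (nu) omP => [v [v0 [f Xf Df] _] | H].
    exists (P ^+ (v.-1 - (minn m v).-1) *: f); first exact: fixZ.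
    by rewrite scalerA -exprD subnKC // -!subn1 leq_sub2r // geq_minr.
  exact: H.
have pM : (p%:Z ^+ M %| d - 1)%Z.
  apply: chi => w; rewrite -(prednK M0) => w0.
  by rewrite scale1r; apply: root_fixed Df Xf w0.
have [->|nMm] := eqVneq m M; first by [].
have [v nuE vm] : exists2 v, nu = Some v & (v < m)%N.
  move: nMm; rewrite /M; case: (nu) => [v|] /=; last by rewrite eqxx.
  by move=> h; exists v => //; rewrite ltnNge; apply/negP => /minn_idPl E; rewrite E eqxx in h.
have ME : M = v by rewrite /M nuE /=; apply/minn_idPr; exact: ltnW.
(* With the same entries, d = 1 has the largest possible valuation, so minimality forces p^m to
   divide d - 1. *)
have np1 : is_norm_pair m a 1.
  by apply: shift nuE vm _; rewrite -ME -opprB rpredN.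
have /orP[h|/andP[_]] := amin' _ _ np1; first by have := lexlt_irr a; rewrite h.
by rewrite subrr {1}/vmin eqxx leq_vmin.
Qed.

End ZXmodule.

(** * The multiplicative group of K as a Z[X]-module *)

Section PolynomialAction.
Context (M : zmodType) (f : {additive M -> M}).
Implicit Types (q r : {poly int}) (u : M).

Definition pact q u : M := \sum_(i < size q) iter i f u *~ q`_i.

Lemma iter_additive i : {morph iter i f : u v / u + v}.
Proof. by elim: i => [|i IH] u v; rewrite ?iterS ?IH ?raddfD. Qed.

Lemma pact_wide k q u : (size q <= k)%N -> pact q u = \sum_(i < k) iter i f u *~ q`_i.
Proof.
move=> qk; rewrite /pact (big_ord_widen k (fun i => iter i f u *~ q`_i)) // big_mkcond.
by apply: eq_bigr => i _; case: ltnP => // qi; rewrite nth_default // mulr0z.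
Qed.

Lemma pactDr q : {morph pact q : u v / u + v}.
Proof.
by move=> u v; rewrite /pact -big_split; apply: eq_bigr => i _; rewrite /= iter_additive mulrzDl.
Qed.

Lemma pactDl u : {morph pact^~ u : q r / q + r}.
Proof.
move=> q r; rewrite !(@pact_wide (maxn (size q) (size r))) ?leq_maxl ?leq_maxr ?size_polyD //.
by rewrite -big_split; apply: eq_bigr => i _; rewrite /= coefD mulrzDr.
Qed.

Lemma pactC c u : pact c%:P u = u *~ c.
Proof. by rewrite (@pact_wide 1) ?size_polyC_leq1 // big_ord1 coefC. Qed.

Lemma pact1 : left_id 1 pact.
Proof. by move=> u; rewrite -polyC1 pactC mulr1z. Qed.

Lemma pactMX q u : pact (q * 'X) u = pact q (f u).
Proof.
rewrite (@pact_wide (size q).+1); last first.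
  by rewrite (leq_trans (size_polyMleq _ _)) // size_polyX addn2.
rewrite big_ord_recl coefMX mulr0z add0r; apply: eq_bigr => i _.
by rewrite coefMX /= -iterSr.
Qed.

Lemma pact_comm q u : f (pact q u) = pact q (f u).
Proof.
rewrite /pact raddf_sum; apply: eq_bigr => i _; by rewrite raddfMz -iterSr.
Qed.

Lemma pactZ c q u : pact (c *: q) u = pact q u *~ c.
Proof.
rewrite (@pact_wide (size q)); last by rewrite size_scale_leq.
rewrite /pact mulrz_suml; apply: eq_bigr => i _; by rewrite coefZ mulrC mulrzA.
Qed.

Lemma pactA q r u : pact q (pact r u) = pact (q * r) u.
Proof.
elim/poly_ind: q u => [|q c IH] u; first by rewrite mul0r -polyC0 !pactC !mulr0z.
rewrite mulrDl !pactDl pactMX pactC mul_polyC pactZ pact_comm IH; congr (_ + _).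
by rewrite -mulrA ['X * r]mulrC mulrA pactMX.
Qed.
End PolynomialAction.

(* Phantom in the carrier, s determines the action of X. *)
Definition unit_group (F0 : fieldType) (L : splittingFieldType F0) (K : {subfield L})
  (s : gal_of K) : Type := {x : L | (x \in K) && (x != 0)}.

Section UnitGroup.
Context (F0 : fieldType) (L : splittingFieldType F0) (K : {subfield L}) (s : gal_of K).
Local Notation V := (unit_group s).

HB.instance Definition _ := Choice.copy V {x : L | (x \in K) && (x != 0)}.

Definition uval (u : V) : L := sval u.

Lemma uval_in u : uval u \in K. Proof. by case: u => x /= /andP[]. Qed.
Lemma uval_neq0 u : uval u != 0. Proof. by case: u => x /= /andP[]. Qed.
Lemma uval_inj : injective uval. Proof. exact: val_inj. Qed.

Definition mkunit x (Kx : x \in K) (x0 : x != 0) : V := exist _ x (introT andP (conj Kx x0)).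

Lemma uvalK x (Kx : x \in K) (x0 : x != 0) : uval (mkunit Kx x0) = x. Proof. by []. Qed.

Definition unit_mul (u v : V) : V :=
  mkunit (rpredM (uval_in u) (uval_in v)) (mulf_neq0 (uval_neq0 u) (uval_neq0 v)).
Definition unit_one : V := mkunit (mem1v K) (oner_neq0 L).
Fact invr_neq0_unit u : (uval u)^-1 != 0. Proof. by rewrite invr_eq0 uval_neq0. Qed.
Definition unit_inv (u : V) : V := mkunit (rpredVr (uval_in u)) (invr_neq0_unit u).

Fact unit_mulA : associative unit_mul.
Proof. by move=> u v w; apply: uval_inj; exact: mulrA. Qed.
Fact unit_mulC : commutative unit_mul.
Proof. by move=> u v; apply: uval_inj; exact: mulrC. Qed.
Fact unit_mul1 : left_id unit_one unit_mul.
Proof. by move=> u; apply: uval_inj; exact: mul1r. Qed.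
Fact unit_mulV : left_inverse unit_one unit_inv unit_mul.
Proof. by move=> u; apply: uval_inj; apply: mulVf; exact: uval_neq0. Qed.

HB.instance Definition _ :=
  GRing.isZmodule.Build V unit_mulA unit_mulC unit_mul1 unit_mulV.

Lemma uvalD u v : uval (u + v) = uval u * uval v. Proof. by []. Qed.
Lemma uvalN u : uval (- u) = (uval u)^-1. Proof. by []. Qed.
Lemma uval0 : uval 0 = 1. Proof. by []. Qed.
Lemma uval_sum (I : Type) (r : seq I) (Q : pred I) (F : I -> V) :
  uval (\sum_(i <- r | Q i) F i) = \prod_(i <- r | Q i) uval (F i).
Proof. exact: (big_morph uval uvalD uval0). Qed.
Lemma uvalMn u k : uval (u *+ k) = uval u ^+ k.
Proof. by elim: k => [|k IH]; rewrite ?mulr0n // mulrS uvalD IH exprS. Qed.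
Lemma uvalMz u c : uval (u *~ c) = uval u ^ c.
Proof. by case: c => k; rewrite ?NegzE ?mulrNz ?uvalN -?pmulrn uvalMn -?exprnN. Qed.

Fact sact_neq0 (u : V) : s (uval u) != 0.
Proof. by rewrite fmorph_eq0 uval_neq0. Qed.
Definition sact (u : V) : V := mkunit (memv_gal s (uval_in u)) (sact_neq0 u).
Fact sact_zmod : zmod_morphism sact.
Proof.
move=> u v; apply: uval_inj; rewrite /sact uvalK !uvalD !uvalN !uvalK.
by rewrite rmorphM fmorphV.
Qed.
HB.instance Definition _ := GRing.isZmodMorphism.Build V V sact sact_zmod.

HB.instance Definition _ := GRing.Zmodule_isLmodule.Build {poly int} V
  (fun q r u => pactA sact q r u) (pact1 sact)
  (fun q u v => pactDr sact q u v) (fun u q r => pactDl sact u q r).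

Lemma uvalX (u : V) : uval ('X *: u) = s (uval u).
Proof. by rewrite -[X in X *: _]mul1r [_ *: _](pactMX sact) pact1. Qed.
Lemma uvalXn k (u : V) : uval ('X ^+ k *: u) = (s ^+ k)%g (uval u).
Proof.
elim: k => [|k IH]; first by rewrite scale1r expg0 gal_id.
by rewrite exprS -scalerA uvalX IH expgSr galM ?uval_in.
Qed.
Lemma uvalZ c (u : V) : uval (c%:~R *: u) = uval u ^ c.
Proof. by rewrite scaler_int uvalMz. Qed.
Lemma uvalPX p k (u : V) : uval (p%:R ^+ k *: u) = uval u ^+ (p ^ k).
Proof. by rewrite -natrX scaler_nat uvalMn. Qed.
Lemma uval_geom k l (u : V) :
  uval (geom k ('X ^+ l) *: u) = \prod_(i < k) ((s ^+ l) ^+ i)%g (uval u).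
Proof.
rewrite /geom scaler_suml uval_sum; apply: eq_bigr => i _.
by rewrite -exprM uvalXn expgM.
Qed.
End UnitGroup.

(** * Norms and fixed fields in cyclic extensions *)

Section CyclicExtension.
Context (F0 : fieldType) (L : splittingFieldType F0).
Implicit Types (M N K : {subfield L}).

Lemma prod_cycle (gT : finGroupType) (g : gT) (h : gT -> L) :
  \prod_(x in <[g]>%g) h x = \prod_(i < #[g]%g) h (g ^+ i)%g.
Proof.
have -> : <[g]>%g = [set (g ^+ (i : 'I_#[g]%g))%g | i in 'I_#[g]%g].
  apply/setP=> x; apply/idP/imsetP => [/cyclePmin[i ig ->] | [i _ ->]].
    by exists (Ordinal ig).
  exact: mem_cycle.
rewrite big_imset //= => i j _ _ /eqP.
by rewrite eq_expg_mod_order !modn_small // => /eqP/val_inj.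
Qed.

Lemma mem_cyclic_fixed M K (t : gal_of K) x : galois M K -> 'Gal(K / M)%g = <[t]>%g ->
  (x \in M) = (x \in K) && (t x == x).
Proof.
move=> galMK DG; rewrite -[in LHS](galois_fixedField galMK) DG.
have [Kx|nKx] /= := boolP (x \in K); last by apply/negbTE/negP => /mem_fixedFieldP[Kx]; rewrite Kx in nKx.
apply/(fixedFieldP Kx)/eqP => [fx | tx y]; first exact/fx/cycle_id.
case/cycleP=> i ->; elim: i => [|i IH]; first by rewrite gal_id.
by rewrite expgSr galM // IH.
Qed.

Lemma galNorm_cyclic M K (t : gal_of K) x : 'Gal(K / M)%g = <[t]>%g ->
  galNorm M K x = \prod_(i < #[t]%g) (t ^+ i)%g x.
Proof. by move=> DG; rewrite /galNorm DG (prod_cycle t (fun g => g x)). Qed.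

(** Gal(K/M) is abelian, so N is normal over M, and restriction to N maps t to a generator of
    Gal(N/M), whose order is [N : M]. *)
Lemma galNorm_cyclic_sub M N K (t : gal_of K) x : galois M K -> 'Gal(K / M)%g = <[t]>%g ->
  (M <= N <= K)%VS -> x \in N ->
  galNorm M N x = \prod_(i < \dim_M N) (t ^+ i)%g x.
Proof.
move=> galMK DG sMNK Nx; have [sMN sNK] := andP sMNK.
have galNK : galois N K by exact: galoisS sMNK galMK.
have nMN : normalField M N.
  have nsub : ('Gal(K / N) <| 'Gal(K / M))%g.
    have sub := galS K sMN; rewrite /normal sub DG cents_norm //.
    by apply: subset_trans (cycle_abelian t) _; apply: centS; rewrite -DG.
  have := normal_fixedField_galois galMK nsub.
  by rewrite (galois_fixedField galNK) => /and3P[].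
pose c := normalField_cast_morphism sMNK nMN.
have tG : t \in 'Gal(K / M)%g by rewrite DG cycle_id.
have DN : 'Gal(N / M)%g = <[c t]>%g.
  by rewrite -morphim_cycle // -DG -(normalField_img galMK sMNK nMN).
rewrite (galNorm_cyclic _ DN) -[#[_]%g]/#|<[c t]>%g| -DN.
rewrite -(galois_dim (normalField_galois galMK sMNK nMN)); apply: eq_bigr => i _.
by rewrite -morphX //= (normalField_cast_eq sMNK nMN) ?groupX.
Qed.
End CyclicExtension.

(** * Roots of unity of p-power order *)

Section RootsOfUnity.
Context (F0 : fieldType) (L : splittingFieldType F0) (p : nat) (xi : L).
Hypotheses (p_pr : prime p) (xi_prim : p.-primitive_root xi).

(** Forward: z^(p^k) is a primitive p-th root, so xi is a power of it, and the same power of z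
    works. Backward: the order of y divides p^(k+1) but not p^k, since xi is not 1. *)
Lemma mu_sub_root (E : {subfield L}) k :
  mu_sub p E k.+1 <-> exists2 y, y \in E & y ^+ (p ^ k) = xi.
Proof.
split=> [[z [Ez pz]] | [y Ey Dy]].
  have pz1 : p.-primitive_root (z ^+ (p ^ k)).
    have := dvdn_prim_root pz (dvdn_exp (ltn0Sn k) (dvdnn p)).
    by rewrite expnSr mulnK ?prime_gt0.
  have [j Dj] := prim_rootP pz1 (prim_expr_order xi_prim).
  by exists (z ^+ j); [exact: rpredX | rewrite Dj -!exprM mulnC].
exists y; split=> //.
have y1 : y ^+ (p ^ k.+1) = 1 by rewrite expnSr exprM Dy prim_expr_order.
have [l pl] := prim_order_exists (ltac:(by rewrite expn_gt0 prime_gt0) : (0 < p ^ k.+1)%N) y1.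
case/(dvdn_pfactor _ _ p_pr) => j jk Dl; rewrite Dl in pl.
have [jk'|jk'] := leqP j k; last by have -> : k.+1 = j by apply/eqP; rewrite eqn_leq jk jk'.
have xi1 : xi = 1 by rewrite -Dy -(subnKC jk') expnD exprM (prim_expr_order pl) expr1n.
have := prim_order_dvd xi_prim 1; rewrite expr1 xi1 eqxx dvdn1 => /eqP p1.
by have := prime_gt1 p_pr; rewrite p1.
Qed.
End RootsOfUnity.

(** * Translation of norm pairs from fields to modules *)

Section NormPairsOfUnits.
Context (F0 : fieldType) (L : splittingFieldType F0) (F K : {subfield L}) (p n : nat).
Context (s : gal_of K) (Ki : nat -> {subfield L}) (xi : L).
Hypotheses (p_pr : prime p) (n_gt0 : (0 < n)%N) (galFK : galois F K).
Hypotheses (DG : 'Gal(K / F)%g = <[s]>%g) (os : #[s]%g = (p ^ n)%N).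
Hypothesis KiP : forall i, (i <= n)%N ->
  [/\ (F <= Ki i)%VS, (Ki i <= K)%VS & \dim_F (Ki i) = (p ^ i)%N].
Hypotheses (xiF : xi \in F) (xi_prim : p.-primitive_root xi).

Local Notation V := (unit_group s).

Fact sub_FK : (F <= K)%VS. Proof. by case/and3P: galFK. Qed.
Fact xi_in : xi \in K. Proof. exact: subvP sub_FK _ xiF. Qed.
Fact xi_nz : xi != 0.
Proof.
apply/eqP => x0; have := prim_expr_order xi_prim.
by rewrite x0 expr0n gtn_eqF ?prime_gt0 // => /eqP; rewrite eq_sym oner_eq0.
Qed.

Definition xi_unit : V := mkunit s xi_in xi_nz.

(** Gal(K/K_i) has order p^(n-i) by the tower law, and a cyclic group has only one subgroup of a
    given order. *)
Lemma Ki_galois i : (i <= n)%N ->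
  galois (Ki i) K /\ 'Gal(K / Ki i)%g = <[s ^+ (p ^ i)]>%g.
Proof.
move=> iN; have [sFKi sKiK dKi] := KiP iN.
have galKi : galois (Ki i) K by apply: (@galoisS _ _ F); rewrite ?sFKi.
have pi0 : (0 < p ^ i)%N by rewrite expn_gt0 prime_gt0.
have card : #|'Gal(K / Ki i)%g| = (p ^ (n - i))%N.
  rewrite -galois_dim //; apply/eqP.
  rewrite -(eqn_pmul2r pi0) -expnD subnK // -(eqn_pmul2r (adim_gt0 F)).
  rewrite -mulnA -{1}dKi -(dim_sup_field sFKi) -(dim_sup_field sKiK).
  by rewrite (dim_sup_field sub_FK) (galois_dim galFK) DG -os.
split=> //; have dv : (p ^ (n - i) %| #[s]%g)%N by rewrite os dvdn_exp2l ?leq_subr.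
have := cycle_sub_group dv; move/setP/(_ 'Gal(K / Ki i)%G).
rewrite !inE card eqxx andbT -DG galS // => /esym/eqP/(congr1 val) /= ->.
by rewrite os -{1}(subnK iN) expnD mulKn // expn_gt0 prime_gt0.
Qed.

Lemma fixed_Ki i (u : V) : (i <= n)%N -> fixed p i u <-> uval u \in Ki i.
Proof.
move=> iN; have [galKi DGi] := Ki_galois iN.
rewrite (mem_cyclic_fixed _ galKi DGi) uval_in /=; split=> [fu|/eqP su].
  by rewrite -uvalXn fu.
by apply: uval_inj; rewrite uvalXn.
Qed.

Lemma fixed_F (u : V) : 'X *: u = u <-> uval u \in F.
Proof.
rewrite (mem_cyclic_fixed _ galFK DG) uval_in /=; split=> [fu|/eqP su].
  by rewrite -uvalX fu.
by apply: uval_inj; rewrite uvalX.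
Qed.

Lemma unit_Xn (u : V) : 'X ^+ (p ^ n) *: u = u.
Proof. by apply: uval_inj; rewrite uvalXn -os expg_order gal_id. Qed.

Lemma uval_norm (u : V) : uval (geom (p ^ n) 'X *: u) = galNorm F K (uval u).
Proof. by rewrite -['X]expr1 uval_geom expg1 (galNorm_cyclic _ DG) os. Qed.

Lemma uval_subnorm (u : V) : uval u \in Ki n.-1 ->
  uval (geom (p ^ n.-1) 'X *: u) = galNorm F (Ki n.-1) (uval u).
Proof.
move=> ui; have [sFKi sKiK dKi] := KiP (leq_pred n).
rewrite -['X]expr1 uval_geom expg1 (galNorm_cyclic_sub galFK DG) ?sFKi //.
by rewrite dKi.
Qed.

Lemma unit_hilbert90 i (u : V) : (i <= n)%N ->
  geom (p ^ (n - i)) ('X ^+ (p ^ i)) *: u = 0 -> exists w, u = ('X ^+ (p ^ i) - 1) *: w.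
Proof.
move=> iN u0; have [galKi DGi] := Ki_galois iN.
have gen : generator 'Gal(K / Ki i)%g (s ^+ (p ^ i))%g by rewrite /generator DGi.
have /(Hilbert's_theorem_90 gen (uval_in u))[b [Kb b0] Db] : galNorm (Ki i) K (uval u) == 1.
  by rewrite (galNorm_cyclic _ DGi) (orderXexp _ os) -uval_geom u0.
(* Hilbert 90 yields b / tau(b), while the map tau - 1 is wanted, hence the inverse of b. *)
exists (- mkunit s Kb b0); apply: uval_inj.
by rewrite scalerBl scale1r opprK scalerN uvalD uvalN uvalXn uvalK Db mulrC.
Qed.

Lemma xi_unit_neq0 : xi_unit != 0.
Proof.
apply/eqP => /(congr1 (@uval _ _ _ _)); rewrite uvalK uval0 => xi1.
have := prim_order_dvd xi_prim 1; rewrite expr1 xi1 eqxx dvdn1 => /eqP p1.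
by have := prime_gt1 p_pr; rewrite p1.
Qed.

Lemma xi_unit_fixed : 'X *: xi_unit = xi_unit.
Proof. by apply/fixed_F; rewrite uvalK. Qed.

Lemma uvalP (u : V) : uval (p%:R *: u) = uval u ^+ p.
Proof. by rewrite scaler_nat uvalMn. Qed.

Lemma xi_unit_torsion : p%:R *: xi_unit = 0.
Proof. by apply: uval_inj; rewrite uvalP uvalK prim_expr_order. Qed.

Lemma unit_torsion (u : V) : p%:R *: u = 0 -> exists k : int, u = k%:~R *: xi_unit.
Proof.
move=> /(congr1 (@uval _ _ _ _)); rewrite uvalP uval0 => /(prim_rootP xi_prim)[k Dk].
by exists k%:Z; apply: uval_inj; rewrite uvalZ uvalK Dk.
Qed.

Lemma is_mu_level_root (E : {subfield L}) (Q : V -> Prop) w :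
  (E <= K)%VS -> (forall u, Q u <-> uval u \in E) -> xi \in E ->
  is_mu_level p E w -> root_level p xi_unit Q w.
Proof.
move=> sEK QE Exi.
have rootE k : (exists2 y, Q y & p%:R ^+ k *: y = xi_unit) <-> mu_sub p E k.+1.
  split=> [[y Qy Dy] | /(mu_sub_root p_pr xi_prim)[y Ey Dy]].
    apply/(mu_sub_root p_pr xi_prim); exists (uval y); first exact/QE.
    by rewrite -uvalPX Dy.
  have y0 : y != 0.
    apply: contraNneq xi_nz => y0; rewrite -Dy y0 expr0n.
    by rewrite gtn_eqF // expn_gt0 prime_gt0.
  exists (mkunit s (subvP sEK _ Ey) y0); first exact/QE.
  by apply: uval_inj; rewrite uvalPX.
case: w => [[|k]|] /=.
- case=> _ []; apply/rootE; exists xi_unit; first exact/QE.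
  by rewrite expr0 scale1r.
- case=> /rootE muk nmuk; split=> // y Qy; apply/eqP => Dy.
  by apply: nmuk; apply/rootE; exists y.
by move=> H k; apply/rootE.
Qed.

Lemma norm_repE d e m a alpha delta : d = 1 + p%:Z * e ->
  all (entry_le n) a -> size a = m -> (0 < m)%N -> olt_minf (nth None a 0) (Some n) ->
  norm_rep p n xi_unit d e m a 1 alpha delta <->
  [/\ forall i, (i < m)%N -> match nth None a i with
        | Some k => uval (delta i) \in Ki k /\ uval (delta i) != 0
        | None => uval (delta i) = 1 end,
      s (uval alpha) = uval alpha ^ d * \prod_(i < m.+1) uval (delta i) ^+ (p ^ i)
    & xi = galNorm F K (uval alpha) ^ ((d - 1) %/ p)%Z
           * galNorm F (Ki n.-1) (uval (delta 0%N))
           * \prod_(1 <= i < m.+1) galNorm F K (uval (delta i)) ^+ (p ^ i.-1)].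
Proof.
move=> Dd an sz m0 a0.
have De : ((d - 1) %/ p)%Z = e.
  by rewrite Dd addrAC subrr add0r mulKz // -lt0n prime_gt0.
have fitE : fits p m a delta <-> forall i, (i < m)%N -> match nth None a i with
        | Some k => uval (delta i) \in Ki k /\ uval (delta i) != 0
        | None => uval (delta i) = 1 end.
  split=> fit i im; have := fit i im; case Dai: (nth None a i) => [k|].
  - have kn : (k <= n)%N by have := all_nthP None an i; rewrite sz Dai; apply.
    by move/(fixed_Ki _ kn) => ->; rewrite uval_neq0.
  - by move->.
  - have kn : (k <= n)%N by have := all_nthP None an i; rewrite sz Dai; apply.
    by case=> /(fixed_Ki _ kn).
  - by move=> d1; apply: uval_inj.
have sumE : uval (weighted p m delta) = \prod_(i < m.+1) uval (delta i) ^+ (p ^ i).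
  by rewrite uval_sum; apply: eq_bigr => i _; rewrite uvalPX.
have eqE : ('X - d%:~R) *: alpha = weighted p m delta <->
    s (uval alpha) = uval alpha ^ d * \prod_(i < m.+1) uval (delta i) ^+ (p ^ i).
  rewrite -sumE -uvalX -uvalZ -uvalD scalerBl; split=> [<-|/uval_inj ->].
    by rewrite addrC subrK.
  by rewrite addrC addKr.
have normE : fits p m a delta ->
    uval (e%:~R *: (geom (p ^ n) 'X *: alpha) + weighted_norm p n m delta)
    = galNorm F K (uval alpha) ^ ((d - 1) %/ p)%Z * galNorm F (Ki n.-1) (uval (delta 0%N))
           * \prod_(1 <= i < m.+1) galNorm F K (uval (delta i)) ^+ (p ^ i.-1).
  move=> fit; rewrite uvalD uvalZ uval_norm De /weighted_norm uvalD mulrA.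
  (* delta_0 lies in K_(n-1) because a_0 < n. *)
  rewrite uval_subnorm; last first.
    apply/(fixed_Ki _ (leq_pred n)); have := fit 0 m0.
    case: (nth None a 0) a0 => [k /= kn | _ -> ]; last by rewrite /fixed scaler0.
    by apply: fixed_leq; rewrite -ltnS prednK.
  congr (_ * _); rewrite big_add1 /= big_mkord uval_sum.
  by apply: eq_bigr => i _; rewrite uvalPX uval_norm.
split=> [[fit Da Dn] | [/fitE fit /eqE Da Dn]]; split=> //.
- exact/fitE.
- exact/eqE.
- by rewrite -normE // Dn scale1r uvalK.
by apply: uval_inj; rewrite normE // -Dn scale1r uvalK.
Qed.

Lemma norm_pairE m a d : (0 < m)%N ->
  norm_pair p n F K s Ki xi m a d <-> is_norm_pair p n xi_unit m a d.
Proof.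
move=> m0; split.
  case=> sz an a0 /dvdzP[e De] [alpha [delta [[Ka a_nz] [Kdm dm_nz] fit Da Dn]]].
  have Dd : d = 1 + p%:Z * e by rewrite mulrC -De addrC subrK.
  have delta_in i : (i <= m)%N -> (delta i \in K) && (delta i != 0).
    rewrite leq_eqVlt => /orP[/eqP->|im]; first by rewrite Kdm.
    have := fit i im; case Dai: (nth None a i) => [k|]; last by move->; rewrite mem1v oner_neq0.
    have kn : (k <= n)%N by have := all_nthP None an i; rewrite sz Dai; apply.
    by have [_ sKiK _] := KiP kn; case=> /(subvP sKiK) -> ->.
  (* Beyond index m nothing is known about delta; where it leaves K^* the unit element is the
     default. *)
  have [dV dVE] : exists dV : nat -> V, forall i, (i <= m)%N -> uval (dV i) = delta i.
    exists (fun i => if (insub (delta i) : option {x : L | (x \in K) && (x != 0)}) is Some v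
                     then (v : V) else 0).
    move=> i im; case: insubP => [v _ Dv|]; [exact: Dv | by rewrite delta_in].
  exists e, (mkunit s Ka a_nz), dV; split=> //.
  apply/norm_repE => //; split.
  - by move=> i im; have := fit i im; rewrite dVE // ltnW.
  - by rewrite uvalK Da; congr (_ * _); apply: eq_bigr => i _; rewrite dVE // -ltnS.
  rewrite uvalK Dn dVE //; congr (_ * _); rewrite !big_add1 !big_mkord.
  by apply: eq_bigr => i _; rewrite dVE.
case=> e [alpha [delta [Dd [sz an a0] /norm_repE-/(_ Dd an sz m0 a0)[fit Da Dn]]]].
split=> //; first by rewrite Dd addrAC subrr add0r dvdz_mulr.
exists (uval alpha), (fun i => uval (delta i)); split=> //; split; rewrite ?uval_in ?uval_neq0 //.
Qed.

Lemma minimal_norm_pairE m a d : (0 < m)%N ->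
  minimal_norm_pair p n F K s Ki xi m a d <-> is_minimal p n xi_unit m a d.
Proof.
move=> m0; split=> -[np npmin]; split.
- exact/norm_pairE.
- by move=> a' d' /(norm_pairE _ _ m0)/npmin.
- exact/norm_pairE.
by move=> a' d' /(norm_pairE _ _ m0)/npmin.
Qed.

(** Such a z is a primitive 4th root of unity in K, so nu > 1. As omega = 1 < nu is excluded, F also
    contains one, and z is a power of it. *)
Lemma mu4_fixed_unit omega nu :
  root_level p xi_unit (fun y => 'X *: y = y) omega -> root_level p xi_unit (fun=> True) nu ->
  ~ (p = 2%N /\ omega = Some 1%N /\ olt_inf (Some 1%N) nu) ->
  p = 2%N -> forall z : V, p%:R *: z = xi_unit -> 'X *: z = z.
Proof.
move=> omP nuP excl p2 z Dz.
have [f Xf Df] : exists2 f, 'X *: f = f & p%:R ^+ 1 *: f = xi_unit.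
  case: omega omP excl => [[|[|k]]|] omP excl; [by case: omP | | | exact: omP 1%N].
    case: excl; split=> //; split=> //; case: nu nuP => [[|[|l]]|] //=; first by case.
    by case=> _ _ /(_ z I); rewrite expr1 Dz eqxx.
  case: omP => _ [f Xf Df] _; exists (p%:R ^+ k *: f); first exact: fixZ.
  by rewrite scalerA -exprD add1n.
apply: (root_fixed unit_torsion Df Xf).
by rewrite exprSr -scalerA Dz expr1 xi_unit_torsion.
Qed.
End NormPairsOfUnits.

Theorem theorem1 (F0 : fieldType) (L : splittingFieldType F0)
  (F K : {subfield L}) (p n : nat) (s : gal_of K) (Ki : nat -> {subfield L})
  (xi : L) (omega nu : option nat) (m : nat) (a : seq (option nat)) (d : int) :
  prime p -> (0 < n)%N -> p \notin [pchar L] ->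
  galois F K -> 'Gal(K / F)%g = <[s]>%g -> #[s]%g = (p ^ n)%N ->
  (forall i, (i <= n)%N ->
     [/\ (F <= Ki i)%VS, (Ki i <= K)%VS & \dim_F (Ki i) = (p ^ i)%N]) ->
  is_mu_level p F omega -> is_mu_level p K nu ->
  xi \in F -> p.-primitive_root xi ->
  (p = 2%N -> n = 1%N -> exists x : L, [/\ x \in K, x != 0 & galNorm F K x = -1]) ->
  ~ (p = 2%N /\ omega = Some 1%N /\ olt_inf (Some 1%N) nu) ->
  (0 < m)%N ->
  minimal_norm_pair p n F K s Ki xi m a d ->
  [/\ olt_inf omega nu ->
        forall dt : int, congr_ext p nu dt d ->
          minimal_norm_pair p n F K s Ki xi m a dt,
      omega = nu -> (d == 1 %[mod (p ^ m)%N])%Z &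
      forall c : int, chi_mod_spec p s (min_ext m nu) c ->
        (d == c %[mod (p ^ min_ext m nu)%N])%Z].
Proof.
move=> p_pr n_gt0 _ galFK DG os KiP muF muK xiF xi_prim minus1 excl m0 amin.
pose xiV := xi_unit s p_pr galFK xiF xi_prim.
have omP : root_level p xiV (fun y => 'X *: y = y) omega.
  by apply: is_mu_level_root muF => //; [exact: sub_FK galFK | exact: fixed_F galFK DG].
have nuP : root_level p xiV (fun=> True) nu.
  by apply: is_mu_level_root muK => //; [move=> u; rewrite uval_in | exact: xi_in galFK xiF].
have norm_xi : p = 2%N -> n = 1%N -> exists x : unit_group s, geom (p ^ n) 'X *: x = xiV.
  move=> p2 n1; have [x [Kx x0 Nx]] := minus1 p2 n1.
  exists (mkunit s Kx x0); apply: uval_inj; rewrite (uval_norm DG os) !uvalK Nx.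
  (* For p = 2 the primitive p-th root of unity is -1. *)
  have /eqP := prim_expr_order xi_prim; rewrite p2 sqrf_eq1 => /orP[/eqP xi1|/eqP-> //].
  by have := prim_order_dvd xi_prim 1; rewrite expr1 xi1 eqxx p2.
have minE a' d' := minimal_norm_pairE p_pr n_gt0 galFK DG os KiP xiF xi_prim a' d' m0.
have /minE amin' := amin.
have [c1 c2 c3] := minimal_norm_pairs p_pr n_gt0 (unit_Xn os)
  (unit_hilbert90 p_pr galFK DG os KiP)
  (xi_unit_neq0 s p_pr galFK xiF xi_prim) (xi_unit_fixed p_pr galFK DG xiF xi_prim)
  (xi_unit_torsion s p_pr galFK xiF xi_prim) (unit_torsion (s := s) p_pr galFK xiF xi_prim)
  norm_xi (mu4_fixed_unit omP nuP excl) omP nuP m0 amin'.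
split=> [omnu dt pdt|omnu|c chi].
- exact/minE/(c1 omnu).
- by rewrite eqz_mod_dvd PoszX c2.
rewrite eqz_mod_dvd PoszX; apply: c3 => z z0; apply: uval_inj; rewrite uvalX uvalZ.
by apply: chi; rewrite ?uval_in // -uvalPX z0.
Qed.
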